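(* For a given orthonormal frame field $e_x$, the group of parallel transports of Riemannian space $DP$ is uniquely determined (that is, the deformation maps $\bar H_x$ and $\pi_x$ with the help of which $DP$ is constructed are uniquely determined by $e_x$).
   Context: All considerations are local: they take place within a coordinate domain of the manifold, and groups are understood as local groups. $X$ is (a coordinate domain regarded as) an affine space with vector space $\widetilde T$; $T$ is a vector space isomorphic to $\widetilde T$, with a fixed Euclidean metric $\eta$; $\partial_x:=\partial/\partial x$. **Deformed gauge group of translations $T_X^{gH}$.** The gauge group of translations $T_X^g$ consists of smooth vector functions $x\mapsto\tilde t_x\in\widetilde T$ with $|1+\partial_x\tilde t_x|\neq0$ and has the multiplication $(\tilde t\times\tilde t')_x=\tilde t_x+\tilde t'_{x'}$, $x'=x+\tilde t_x$. A deformation is a family of invertible maps $H_x:\widetilde T\to T$, depending smoothly on $x\in X$, with $H_x(0)=0$; $K_x:=H_x^{-1}$, $k_x:=\partial K_x(0)$ (derivative at $0$), $h_x:=k_x^{-1}$. The group $T_X^{gH}$ is isomorphic to $T_X^g$, with parameters $t_x=H_x(\tilde t_x)\in T$, multiplication $(t\times t')_x=\varphi_x(t_x,t'_{x'}):=H_x(K_x(t_x)+K_{x'}(t'_{x'}))$, $x'=x+K_x(t_x)$, and action $x\mapsto x+K_x(t_x)$ on $X$. Put $e_x:=k_x\cdot\partial_x$ (a frame field on $X$), $\gamma_x:=\partial\partial'\varphi_x(0,0)$ (derivatives in the first and second arguments), $\nabla_x:=e_x+\gamma_x$. **Group $RT$.** $T_X^{gH}$ is canonical if for any two points $x,x'\in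 X$ there is a smooth parametric curve $x'=x(s)$, $x=x(0)$, such that $\varphi_x(s\tau_x,s'\tau_{x'})=(s+s')\tau_x$, where $\tau_{x'}=h_{x'}\langle\tilde\tau_{x'}\rangle$, $\tilde\tau_{x'}=\dot x'$. A group of Riemannian translations $RT$ is a canonical $T_X^{gH}$ for which $\eta\langle\tau_x,\tau_x\rangle=\eta\langle\tau_{x'},\tau_{x'}\rangle$ along these curves (the unit of scale keeps its length when transported along itself). It defines on $X$ the Riemannian metric $g_x\langle\tilde\tau,\tilde\tau\rangle=\eta\langle h_x\langle\tilde\tau\rangle,h_x\langle\tilde\tau\rangle\rangle$ and the frame field $e_x$, orthonormal for $g$. **Deformed group $G_X^{g\bar H}$.** Let $R^g$ be the gauge rotation group: functions $x\mapsto r_x$ with $r_x$ a linear map of $T$ preserving $\eta$. The group $G_X^g$ (semidirect product of $T_X^g$ and $R^g$) consists of pairs $(\tilde t_x,\tilde r_x)$ with multiplication giving $(\tilde t_x+\tilde t'_{x'},\ \tilde r_x\circ\tilde r'_{x'})$, $x'=x+\tilde t_x$; it describes nonlocal automorphisms of $RT$ preserving the metric $g$, given by $e'_{x'}=\tilde r_x^{-1}\cdot e_{x'}$ and, on the parameters of $RT$ (in the tangent bundle $TX$), by $\tau'_x=\tilde r_x\langle\tau_{x'}\rangle$. The deformed group $G_X^{g\bar H}$ is isomorphic to $G_X^g$ and is parametrized by pairs $\vartheta_x=(t_x,r_x)$ with $\tilde t_x=\bar K_x(t_x)$, $\tilde r_x=r_x\circ\pi_x(t_x)$. Here $\bar H_x$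 is a deformation map (independent, a priori, of the $H_x$ of $RT$), $\bar K_x=\bar H_x^{-1}$, and the maps $\pi_x(t)$ of $T$ preserve $\eta$ for all $x\in X$, $t\in T$, with $\pi_x(0)=1$. Its multiplication has $T$-component $\bar\varphi_x(t_x,t'_{x'}):=\bar H_x(\bar K_x(t_x)+\bar K_{x'}(t'_{x'}))$ and rotation component $r_x\circ\pi_x(t_x)\circ r'_{x'}\circ\pi_{x'}(t'_{x'})\circ\pi_x^{-1}(\bar\varphi_x(t_x,t'_{x'}))$, where $x'=x+\bar K_x(t_x)$. It acts on $X$ by $x\mapsto x'=x+\bar K_x(t_x)$ and in $TX$ by $\tau'_x=r_x\langle\pi_x(t_x)\langle\tau_{x'}\rangle\rangle$. Put $\bar k_x:=\partial\bar K_x(0)$, $\bar e_x:=\bar k_x\cdot\partial_x$, $\bar\gamma_x:=\partial\pi_x(0)$, $\bar\nabla_x:=\bar e_x+\bar\gamma_x$. **Group $DR$.** The group of motions of the tangent bundle of the Riemannian space, $DR$, is a deformed group $G_X^{g\bar H}$ of nonlocal automorphisms of $RT$ preserving the Riemannian structure defined on $X$ by $RT$, for which the consistency condition $\bar\nabla_x=\nabla_x$ holds (that is, $\bar e_x=e_x$ and $\bar\gamma_x=\gamma_x$). **Group $DP$.** A group $DR$ is called the group of parallel transports of Riemannian space, $DP$, if it satisfies the extended canonicity condition: for any two points $x,x'\in X$ there exists a smooth parametric curve $x'=x(s)$, $x=x(0)$, such that $((s\tau,1)\times(s'\tau,1))_x=(\bar\varphi_x(s\tau_x,s'\tau_{x'}),1)=((s+s')\tau_x,1)$,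 where $\tau_{x'}=h_{x'}\langle\tilde\tau_{x'}\rangle$, $\tilde\tau_{x'}=\dot x'$.
   Formalization: The extended canonicity condition of DP is required along curves that also satisfy the canonicity condition of RT; with unrelated curves uniqueness fails (n=1, e=d/dx, H_x(v)=v, π=1: both H̄_x(v)=v and H̄_x(v)=exp(v)−1 qualify). *)

(* Defs.v *)
From HB Require Import structures.
From mathcomp Require Import all_boot all_order all_algebra.
From mathcomp Require Import all_classical all_reals all_analysis.

Set Implicit Arguments.
Unset Strict Implicit.
Unset Printing Implicit Defensive.

Import Order.TTheory GRing.Theory Num.Theory.
Import numFieldNormedType.Exports.

Local Open Scope classical_set_scope.
Local Open Scope ring_scope.

(* MathComp-Analysis, over an arbitrary R : realType.

   Conventions.  The coordinate domain X is an open subset of 'cV[R]_n; both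
   the translation space T~ of the affine space and the space T of parameters
   are 'cV[R]_n, T carrying the Euclidean metric with Gram matrix eta.  Linear
   maps are matrices acting on columns, so composition is *m.

   Groups are local groups: the maps below are total functions, but H_x is only
   meaningful on {v | x + v \in X}, and K_x and pi_x only on the image of that
   set under H_x. *)

(* C^k on the open set A, through iterated directional derivatives. *)
Fixpoint Ck_on (R : realType) (V W : normedModType R) (k : nat)
    (A : set V) (f : V -> W) : Prop :=
  match k with
  | 0%N => forall x, A x -> {for x, continuous f}
  | k'.+1 => (forall x, A x -> differentiable f x) /\
             forall v : V, Ck_on k' A (fun x => 'D_v f x)
  end.

Definition smooth_on (R : realType) (V W : normedModType R)
    (A : set V) (f : V -> W) : Prop := forall k, Ck_on k A f.

Definition bil (R : realType) (n : nat) (b : 'M[R]_n) (u v : 'cV[R]_n) : R :=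
  (u^T *m b *m v) 0 0.

Definition euclidean (R : realType) (n : nat) (b : 'M[R]_n) : Prop :=
  b^T = b /\ forall v : 'cV[R]_n, v != 0 -> 0 < bil b v v.

Definition riemannian_metric (R : realType) (n : nat) (X : set 'cV[R]_n)
    (g : 'cV[R]_n -> 'M[R]_n) : Prop :=
  smooth_on X g /\ forall x, X x -> euclidean (g x).

(* The columns of e x are the vectors of the frame at x, that is, e x is the
   matrix of tau |-> e_x<tau>, from T to the tangent space at x. *)
Definition orthonormal_frame (R : realType) (n : nat) (X : set 'cV[R]_n)
    (eta : 'M[R]_n) (g e : 'cV[R]_n -> 'M[R]_n) : Prop :=
  [/\ smooth_on X e,
      forall x, X x -> e x \in unitmx &
      forall x, X x -> forall u v : 'cV[R]_n,
        bil (g x) (e x *m u) (e x *m v) = bil eta u v].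

Section Deformation.
Context (R : realType) (n : nat) (X : set 'cV[R]_n).
Implicit Types (H : 'cV[R]_n -> 'cV[R]_n -> 'cV[R]_n) (x t tau : 'cV[R]_n).

Definition shifts x : set 'cV[R]_n := [set v | X (x + v)].

Definition params H x : set 'cV[R]_n := H x @` shifts x.

Definition Kmap H x : 'cV[R]_n -> 'cV[R]_n := 'pinv_(fun=> 0) (shifts x) (H x).

Definition is_deformation H : Prop :=
  [/\ forall x, X x -> H x 0 = 0,
      forall x, X x -> {in shifts x &, injective (H x)},
      smooth_on [set p : 'cV[R]_n * 'cV[R]_n | X p.1 /\ shifts p.1 p.2]
        (fun p => H p.1 p.2),
      open [set p : 'cV[R]_n * 'cV[R]_n | X p.1 /\ params H p.1 p.2] &
      smooth_on [set p : 'cV[R]_n * 'cV[R]_n | X p.1 /\ params H p.1 p.2]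
        (fun p => Kmap H p.1 p.2)].

(* k_x, as the Jacobian matrix of K_x at 0; its columns form the frame e_x. *)
Definition kmx H x : 'M[R]_n :=
  \matrix_(i, j) ('D_(delta_mx j 0 : 'cV[R]_n) (Kmap H x) 0) i 0.

Definition hmx H x : 'M[R]_n := invmx (kmx H x).

Definition phi H x t t' : 'cV[R]_n :=
  H x (Kmap H x t + Kmap H (x + Kmap H x t) t').

(* t_x and t'_{x'} can be multiplied in the local group. *)
Definition composable H x t t' : Prop :=
  params H x t /\ params H (x + Kmap H x t) t'.

(* gamma_x<tau><tau'>: tau is fed to the derivative in the first argument
   of phi_x. *)
Definition gamma H x tau tau' : 'cV[R]_n :=
  'D_tau (fun t => 'D_tau' (fun t' => phi H x t t') 0) 0.

Definition velocity H (c : R -> 'cV[R]_n) (s : R) : 'cV[R]_n :=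
  hmx H (c s) *m derive1 c s.

Definition smooth_curve (a b : R) (c : R -> 'cV[R]_n) : Prop :=
  [/\ a < 0 < b, smooth_on (V := R^o) [set` `]a, b[] c &
      forall s, s \in `]a, b[ -> X (c s)].

(* Both tau_{x'} and the second argument of phi_x live at x', hence the
   requirement that x' = x + K_x(s tau_x) be the point c s of the curve. *)
Definition canonical_curve H (a b : R) (c : R -> 'cV[R]_n) : Prop :=
  let x := c 0 in
  let tau := velocity H c in
  smooth_curve a b c /\
  forall s s', s \in `]a, b[ -> s + s' \in `]a, b[ ->
    [/\ composable H x (s *: tau 0) (s' *: tau s),
        c s = x + Kmap H x (s *: tau 0) &
        phi H x (s *: tau 0) (s' *: tau s) = (s + s') *: tau 0].

Definition is_RT (eta : 'M[R]_n) H : Prop :=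
  is_deformation H /\
  forall x x', X x -> X x' -> exists a b c,
    [/\ canonical_curve H a b c,
        c 0 = x,
        exists2 s, s \in `]a, b[ & c s = x' &
        forall s, s \in `]a, b[ ->
          bil eta (velocity H c s) (velocity H c s) =
          bil eta (velocity H c 0) (velocity H c 0)].

(* Value at x of the product in the deformed group given by (Hb, pi), in terms
   of the values at x of the first factor and at x' = x + Kb_x(t_x) of the
   second one. *)
Definition dmul Hb (pi : 'cV[R]_n -> 'cV[R]_n -> 'M[R]_n) x
    (th th' : 'cV[R]_n * 'M[R]_n) : 'cV[R]_n * 'M[R]_n :=
  let: (t, r) := th in
  let: (t', r') := th' in
  let x' := x + Kmap Hb x t in
  let t'' := phi Hb x t t' in
  (t'', r *m pi x t *m r' *m pi x' t' *m invmx (pi x t'')).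

Definition is_rotation_deformation (eta : 'M[R]_n) Hb
    (pi : 'cV[R]_n -> 'cV[R]_n -> 'M[R]_n) : Prop :=
  [/\ smooth_on [set p : 'cV[R]_n * 'cV[R]_n | X p.1 /\ params Hb p.1 p.2]
        (fun p => pi p.1 p.2),
      forall x t, X x -> params Hb x t -> (pi x t)^T *m eta *m pi x t = eta &
      forall x, X x -> pi x 0 = 1%:M].

(* The deformed group of nonlocal automorphisms of the group RT given by H,
   subject to the consistency condition.  That the automorphisms
   e'_{x'} = r~_x^-1 . e_{x'} preserve the metric of RT amounts to r~_x, hence
   pi_x(t), preserving eta. *)
Definition is_DR (eta : 'M[R]_n) H Hb
    (pi : 'cV[R]_n -> 'cV[R]_n -> 'M[R]_n) : Prop :=
  [/\ is_RT eta H,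
      is_deformation Hb,
      is_rotation_deformation eta Hb pi,
      forall x, X x -> kmx Hb x = kmx H x &
      forall x, X x -> forall tau tau',
        'D_tau (pi x) 0 *m tau' = gamma H x tau tau'].

(* The extended condition is imposed along the curves of the canonicity
   condition of RT.  With curves unrelated to those of RT, Hb would not be
   determined by the frame: for n = 1, e = d/dx, H_x(v) = v and pi = 1, both
   Hb_x(v) = v and Hb_x(v) = exp(v) - 1 would do. *)
Definition is_DP (eta : 'M[R]_n) H Hb
    (pi : 'cV[R]_n -> 'cV[R]_n -> 'M[R]_n) : Prop :=
  is_DR eta H Hb pi /\
  forall x x', X x -> X x' -> exists a b c,
    [/\ canonical_curve H a b c,
        c 0 = x,
        exists2 s, s \in `]a, b[ & c s = x' &
        let tau := velocity H c in
        forall s s', s \in `]a, b[ -> s + s' \in `]a, b[ ->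
          [/\ composable Hb x (s *: tau 0) (s' *: tau s),
              c s = x + Kmap Hb x (s *: tau 0) &
              dmul Hb pi x (s *: tau 0, 1%:M) (s' *: tau s, 1%:M) =
              ((s + s') *: tau 0, 1%:M)]].

End Deformation.

(* Main.v *)
(** The connection [gamma] is determined by the frame: its antisymmetric part
    is the structure function of [e], because the second derivative of [K_x]
    at [0] is symmetric, while consistency makes it the derivative of a
    rotation, hence antisymmetric for [eta]; this is the uniqueness of the
    Levi-Civita connection.  Canonicity turns the curves into solutions of the
    geodesic equation [c' = e tau, tau' = - gamma tau tau], along which the
    extended condition gives [pi' = pi gamma].  So [Kb_x] and [pi_x] are read
    off one ordinary differential equation, on a star-shaped set of parameters.
    Uniqueness of its solutions identifies the two groups on the parameters
    they share; a continuation argument along rays shows that they share all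
    of them. *)

Require Import Defs.
From HB Require Import structures.
From mathcomp Require Import all_boot all_order all_algebra.
From mathcomp Require Import all_classical all_reals all_analysis.
From mathcomp Require Import ring lra.

Set Implicit Arguments.
Unset Strict Implicit.
Unset Printing Implicit Defensive.

Import Order.TTheory GRing.Theory Num.Theory.
Import numFieldNormedType.Exports.

Local Open Scope classical_set_scope.
Local Open Scope ring_scope.

(** The two groups share nothing but the frame: their maps [H], their curves and their parameter
    domains may all differ, so they can only be compared through quantities that [e] determines. The
    bridge is one identity. [phi] mixes [H] at [x] with [K] at [x']; multiplying its derivative in
    the second argument by the Jacobian of [K_x] cancels [H] and leaves the frame at the translated
    point. Differentiating once more at 0 gives K''(u, v) + e gamma(u, v) = (D_{e u} e) v, where K''
    is the second derivative of [K_x] at 0. Antisymmetrized, this is the torsion; on the diagonal it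
    is the acceleration of a canonical curve. Velocities involve the inverse of the frame, and
    orthonormality writes it as eta^-1 e^T g, which is visibly differentiable. The resulting
    equation is quadratic in the velocity and lives on [X] only, so its uniqueness theorem asks for
    a Lipschitz comparison just near the times at which two solutions meet. *)

(** * Directional derivatives, matrix-valued maps, slices of smooth maps *)

Section DirectionalDerivatives.
Context (R : realType).
Implicit Types U V W : normedModType R.

Lemma is_derive_comp U V W (c : U -> V) (f : V -> W) u w dc :
  differentiable c u -> 'D_w c u = dc -> differentiable f (c u) ->
  is_derive u w (f \o c) ('D_dc f (c u)).
Proof.
move=> dcu <- df; have dfc : differentiable (f \o c) u.
  exact: differentiable_comp.
apply: DeriveDef; first exact: diff_derivable.
by rewrite !deriveE// diff_comp.
Qed.

Lemma is_derive_along V W (c : R -> V) (f : V -> W) (s : R) dc :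
  is_derive s 1 c dc -> differentiable f (c s) ->
  is_derive s 1 (f \o c) ('D_dc f (c s)).
Proof.
move=> [dcs e] df; apply: is_derive_comp => //; exact/derivable1_diffP.
Qed.

Lemma is_derive_entry V m n (M : V -> 'M[R]_(m, n)) x v dM i j :
  is_derive x v M dM -> is_derive x v (fun y => M y i j) (dM i j).
Proof.
move=> [dMx <-]; apply: DeriveDef; first exact: (derivable_mxP M x v).1.
by rewrite derive_mx// mxE.
Qed.

Lemma is_derive_mx V m n (M : V -> 'M[R]_(m, n)) x v
    (dM : 'M[R]_(m, n)) :
  (forall i j, is_derive x v (fun y => M y i j) (dM i j)) ->
  is_derive x v M dM.
Proof.
move=> h; have d : derivable M x v.
  by apply/derivable_mxP => i j; have [] := h i j.
apply: DeriveDef => //.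
by rewrite derive_mx//; apply/matrixP => i j; rewrite mxE; have [] := h i j.
Qed.

Lemma is_derive_mul V (f g : V -> R) x v df dg :
  is_derive x v f df -> is_derive x v g dg ->
  is_derive x v (fun y => f y * g y) (df * g x + f x * dg).
Proof.
move=> hf hg; have := is_deriveM hf hg => h.
apply: (is_derive_eq h).
by rewrite /GRing.scale/= addrC [g x * df]mulrC.
Qed.

Lemma is_derive_bigsum V W n (h : 'I_n -> V -> W) x v dh :
  (forall i, is_derive x v (h i) (dh i)) ->
  is_derive x v (fun y => \sum_i h i y) (\sum_i dh i).
Proof.
by move=> hh; rewrite -fct_sumE; exact: is_derive_sum.
Qed.

Lemma is_derive_mulmx V m n p (A : V -> 'M[R]_(m, n)) (B : V -> 'M[R]_(n, p))
    x v dA dB :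
  is_derive x v A dA -> is_derive x v B dB ->
  is_derive x v (fun y => A y *m B y) (dA *m B x + A x *m dB).
Proof.
move=> hA hB; apply: is_derive_mx => i j.
rewrite mxE [X in X + _]mxE [X in _ + X]mxE -big_split/=.
under [X in is_derive _ _ X _]eq_fun do rewrite mxE.
by apply: is_derive_bigsum => k; apply: is_derive_mul; exact: is_derive_entry.
Qed.

Lemma derive_basis n W (f : 'cV[R]_n -> W) x v : differentiable f x ->
  'D_v f x = \sum_j v j 0 *: 'D_(delta_mx j 0) f x.
Proof.
move=> df; rewrite deriveE// {1}[v]matrix_sum_delta.
rewrite linear_sum/=; apply: eq_bigr => j _.
by rewrite big_ord1 linearZ/= deriveE.
Qed.

(** A derivative of the slice in direction [v] is the slice of the derivative of [f] in direction
    [(v, 0)]; hence the induction over all [f]. *)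
Lemma Ck_on_slice1 U V W k (A : set (U * V)) (f : U * V -> W) y :
  Ck_on k A f -> Ck_on k [set x | A (x, y)] (fun x => f (x, y)).
Proof.
elim: k f => [|k IH] f /=.
  move=> cf x Ax; apply: (@continuous_comp _ _ _ (fun x => (x, y)) f).
    by apply: cvg_pair => //=; exact: cvg_cst.
  exact: cf.
move=> [df Df]; split=> [x Ax|v].
  apply: (@differentiable_comp _ _ _ _ (fun x => (x, y)) f); last exact: df.
  by apply: differentiable_pair.
rewrite (_ : (fun x => _) = fun x => 'D_(v, 0) f (x, y)); first exact: (IH (fun p => 'D_(v, 0) f p) (Df (v, 0))).
apply/funext => x; apply: (congr1 (fun g : R -> W => lim (g @ 0^'))).
apply/funext => h /=; congr (_ *: (f _ - _)).
by rewrite [RHS]surjective_pairing/= scaler0 add0r.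
Qed.

Lemma smooth_on_slice1 U V W (A : set (U * V)) (f : U * V -> W) y :
  smooth_on A f -> smooth_on [set x | A (x, y)] (fun x => f (x, y)).
Proof. by move=> sf k; exact: Ck_on_slice1. Qed.

Lemma derive_slice2 U V W (f : U * V -> W) x y (v : V) :
  'D_v (fun y => f (x, y)) y = 'D_(0, v) f (x, y).
Proof.
apply: (congr1 (fun g : R -> W => lim (g @ 0^'))).
apply/funext => h /=; congr (_ *: (f _ - _)).
by rewrite [RHS]surjective_pairing/= scaler0 add0r.
Qed.

Lemma Ck_on_slice2 U V W k (A : set (U * V)) (f : U * V -> W) x :
  Ck_on k A f -> Ck_on k [set y | A (x, y)] (fun y => f (x, y)).
Proof.
elim: k f => [|k IH] f /=.
  move=> cf y Ay; apply: (@continuous_comp _ _ _ (fun y => (x, y)) f).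
    by apply: cvg_pair => //=; exact: cvg_cst.
  exact: cf.
move=> [df Df]; split=> [y Ay|v].
  apply: (@differentiable_comp _ _ _ _ (fun y => (x, y)) f); last exact: df.
  by apply: differentiable_pair.
rewrite (_ : (fun y => _) = fun y => 'D_(0, v) f (x, y)); first exact: (IH (fun p => 'D_(0, v) f p) (Df (0, v))).
by apply/funext => y; exact: derive_slice2.
Qed.

Lemma smooth_on_slice2 U V W (A : set (U * V)) (f : U * V -> W) x :
  smooth_on A f -> smooth_on [set y | A (x, y)] (fun y => f (x, y)).
Proof. by move=> sf k; exact: Ck_on_slice2. Qed.

Lemma smooth_on_differentiable V W (A : set V) (f : V -> W) x :
  smooth_on A f -> A x -> differentiable f x.
Proof. by move=> /(_ 1%N)[+ _]; exact. Qed.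

Lemma smooth_on_derive V W (A : set V) (f : V -> W) v :
  smooth_on A f -> smooth_on A (fun x => 'D_v f x).
Proof. by move=> sf k; have [_] := sf k.+1; exact. Qed.

Lemma smooth_on_continuous V W (A : set V) (f : V -> W) x :
  smooth_on A f -> A x -> {for x, continuous f}.
Proof. by move=> /(_ 0%N); exact. Qed.

End DirectionalDerivatives.

(** * Induction on the unit interval, mean values, Lipschitz comparison *)

Section RealFunctions.
Context (R : realType).
Implicit Types (f g p q : R -> R) (s : R).

(** Real induction: the supremum of the initial segments on which [P] holds satisfies [P] by
    closedness, and openness would push it further if it were below 1. It propagates equality of
    solutions and, later, membership along rays. *)
Lemma unit_interval_induction (P : R -> Prop) :
  P 0 ->
  (forall s, 0 < s <= 1 -> (forall r, 0 <= r < s -> P r) -> P s) ->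
  (forall s, 0 <= s < 1 -> P s ->
     exists2 e, 0 < e & forall r, s <= r <= s + e -> P r) ->
  forall s, 0 <= s <= 1 -> P s.
Proof.
move=> P0 Pclosed Popen.
pose A := [set s | 0 <= s <= 1 /\ forall r, 0 <= r <= s -> P r].
have A0 : A 0.
  split; first by rewrite lexx ler01.
  by move=> r; rewrite -eq_le => /eqP <-.
have ubA : ubound A 1 by move=> s [/andP[]].
have supA : has_sup A by split; [exists 0|exists 1].
set m := sup A.
have m0 : 0 <= m by apply: sup_upper_bound.
have m1 : m <= 1 by apply: ge_sup => //; exists 0.
have Plt r : 0 <= r < m -> P r.
  move=> /andP[r0 rm]; have mr0 : 0 < m - r by rewrite subr_gt0.
  have [s [_ As]] := sup_adherent mr0 supA.
  by rewrite -/m subKr => rs; apply: As; rewrite r0 ltW.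
have Pm : P m.
  have [m_gt0|] := ltP 0 m; first by apply: Pclosed => //; rewrite m_gt0.
  by move=> mle0; rewrite (_ : m = 0)//; apply/eqP; rewrite eq_le mle0.
have Ple r : 0 <= r <= m -> P r.
  move=> /andP[r0]; rewrite le_eqVlt => /orP[/eqP->//|rm].
  by apply: Plt; rewrite r0.
suff <- : m = 1 by exact: Ple.
apply/eqP; rewrite eq_le m1/= leNgt; apply/negP => mlt1.
have [e e0 Pe] : exists2 e, 0 < e & forall r, m <= r <= m + e -> P r.
  by apply: Popen => //; rewrite m0.
pose d := Num.min e (1 - m).
have d0 : 0 < d by rewrite lt_min e0 subr_gt0.
have : A (m + d).
  split.
    by rewrite addr_ge0 ?(ltW d0)//= -lerBrDl ge_min lexx orbT.
  move=> r /andP[r0 rmd]; have [rm|rm] := leP r m; first by apply: Ple; rewrite r0.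
  by apply: Pe; rewrite (ltW rm)/= (le_trans rmd)// lerD2l ge_min lexx.
by move=> /(sup_upper_bound supA); rewrite -/m gerDl leNgt d0.
Qed.

Lemma eq0_of_left (f : R -> R) s : 0 < s -> {for s, continuous f} ->
  (forall r, 0 <= r < s -> f r = 0) -> f s = 0.
Proof.
move=> s0 cf f0; apply/eqP; rewrite -normr_le0; apply/ler_addgt0Pl => e e0.
have /cvgrPdist_le /(_ _ e0)/nbhs_ballP[d /= d0 dP] := cf.
(* [s / 2] keeps [r] nonnegative, [s - d / 2] brings it within [d] of [s]. *)
pose r := Num.max (s / 2) (s - d / 2).
have rs : r < s by rewrite gt_max; apply/andP; split; lra.
have r0 : 0 <= r by rewrite le_max divr_ge0// ltW.
have rd : s - d / 2 <= r by rewrite le_max lexx orbT.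
have /dP : ball s d r by rewrite /ball/= ger0_norm; lra.
by rewrite (f0 r) ?r0// subr0 addr0.
Qed.

Lemma mean_value (f df : R -> R) (a b : R) : a <= b ->
  (forall x, a <= x <= b -> is_derive x 1 f (df x)) ->
  exists2 c, a <= c <= b & f b - f a = df c * (b - a).
Proof.
move=> ab dfP.
have d1 x : x \in `]a, b[ -> is_derive x 1 f (df x).
  by rewrite in_itv/= => /andP[ax xb]; apply: dfP; rewrite !ltW.
have cf : {within `[a, b], continuous f}.
  by apply: derivable_within_continuous => x; rewrite in_itv/= => /dfP[].
have [c] := MVT_segment ab d1 cf.
by rewrite in_itv/= => cab E; exists c.
Qed.

(** [N] will be the distance between two solutions. The bounds on [p] and [q] themselves make the
    relation stable under products. *)
Definition lip_near (N : R -> R) s p q := exists L, \forall r \near s,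
  [/\ `|p r| <= L, `|q r| <= L & `|p r - q r| <= L * N r].

Lemma lip_near_ge0 N s p q : lip_near N s p q -> exists2 L, 0 <= L &
  \forall r \near s, [/\ `|p r| <= L, `|q r| <= L & `|p r - q r| <= L * N r].
Proof.
move=> [L HL]; exists L => //.
by have [+ _ _] := nbhs_singleton HL; exact: le_trans.
Qed.

Section Algebra.
Context (N : R -> R) (s : R) (N0 : forall r, 0 <= N r).

Lemma lip_nearD p1 q1 p2 q2 : lip_near N s p1 q1 -> lip_near N s p2 q2 ->
  lip_near N s (fun r => p1 r + p2 r) (fun r => q1 r + q2 r).
Proof.
move=> [L1 H1] [L2 H2]; exists (L1 + L2); near=> r.
have [a1 b1 c1] : [/\ `|p1 r| <= L1, `|q1 r| <= L1 & `|p1 r - q1 r| <= L1 * N r].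
  by near: r.
have [a2 b2 c2] : [/\ `|p2 r| <= L2, `|q2 r| <= L2 & `|p2 r - q2 r| <= L2 * N r].
  by near: r.
split; [exact: (le_trans (ler_normD _ _) (lerD a1 a2))|
        exact: (le_trans (ler_normD _ _) (lerD b1 b2))|].
by rewrite opprD addrACA mulrDl (le_trans (ler_normD _ _) (lerD c1 c2)).
Unshelve. all: by end_near. Qed.

Lemma lip_nearM p1 q1 p2 q2 : lip_near N s p1 q1 -> lip_near N s p2 q2 ->
  lip_near N s (fun r => p1 r * p2 r) (fun r => q1 r * q2 r).
Proof.
move=> /lip_near_ge0[L1 L10 H1] /lip_near_ge0[L2 L20 H2].
(* One [L1 * L2] for each term of p1 (p2 - q2) + (p1 - q1) q2. *)
exists (L1 * L2 + L1 * L2); near=> r.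
have [a1 b1 c1] : [/\ `|p1 r| <= L1, `|q1 r| <= L1 & `|p1 r - q1 r| <= L1 * N r].
  by near: r.
have [a2 b2 c2] : [/\ `|p2 r| <= L2, `|q2 r| <= L2 & `|p2 r - q2 r| <= L2 * N r].
  by near: r.
have L120 : 0 <= L1 * L2 by exact: mulr_ge0.
split.
- by rewrite normrM (le_trans (ler_pM _ _ a1 a2))// lerDl.
- by rewrite normrM (le_trans (ler_pM _ _ b1 b2))// lerDl.
- rewrite (_ : _ - _ = p1 r * (p2 r - q2 r) + (p1 r - q1 r) * q2 r); last by ring.
  rewrite (le_trans (ler_normD _ _))// !normrM mulrDl lerD//.
    by rewrite -mulrA ler_pM.
  by rewrite mulrAC ler_pM.
Unshelve. all: by end_near. Qed.

Lemma lip_nearN p q : lip_near N s p q ->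
  lip_near N s (fun r => - p r) (fun r => - q r).
Proof.
move=> [L HL]; exists L; near=> r.
have [a b c] : [/\ `|p r| <= L, `|q r| <= L & `|p r - q r| <= L * N r].
  by near: r.
by split; rewrite ?normrN// -opprD normrN.
Unshelve. all: by end_near. Qed.

Lemma lip_near_sum n (p q : 'I_n -> R -> R) :
  (forall i, lip_near N s (p i) (q i)) ->
  lip_near N s (fun r => \sum_i p i r) (fun r => \sum_i q i r).
Proof.
move=> H; rewrite -!fct_sumE.
elim/big_ind2 : _ => [|p1 q1 p2 q2 h1 h2|i _]; last exact: H.
  exists 0; apply: filterE => r.
  by rewrite subrr normr0 mul0r.
exact: lip_nearD.
Qed.

Lemma lip_near_coord p q : {for s, continuous p} -> {for s, continuous q} ->
  (forall r, `|p r - q r| <= N r) -> lip_near N s p q.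
Proof.
(* The summand 1 makes the bounds strict at [s], so that they persist nearby, and gives [1 <= L] for
   the difference. *)
move=> cp cq pq; pose L := 1 + `|p s| + `|q s|; exists L.
have L1 : 1 <= L by rewrite /L -addrA lerDl addr_ge0.
near=> r; split.
- near: r; apply: cvgr_norm_le cp _ _ => //.
  by rewrite /L addrAC ltrDr ltr_wpDr.
- near: r; apply: cvgr_norm_le cq _ _ => //.
  by rewrite /L ltrDr ltr_wpDr.
- by rewrite (le_trans (pq r))// ler_peMl.
Unshelve. all: by end_near. Qed.

End Algebra.

End RealFunctions.

(** * Uniqueness of solutions of differential equations *)

Section OdeUniqueness.
Context (R : realType) (I : finType).

(** Gronwall by contraction: on an interval of length [e], the mean value theorem bounds the maximum
    of the sum of the [|f j|] by #|I| L e times itself, and [e] is chosen to make this factor at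
    most 1/2. *)
Lemma eq0_of_deriv_le (f df : I -> R -> R) (s d L : R) : 0 < d -> 0 <= L ->
  (forall i r, s <= r <= s + d -> is_derive r 1 (f i) (df i r)) ->
  (forall i r, s <= r <= s + d -> `|df i r| <= L * \sum_j `|f j r|) ->
  (forall i, f i s = 0) ->
  exists2 e, 0 < e & forall r, s <= r <= s + e -> forall i, f i r = 0.
Proof.
move=> d0 L0 fdf dfL f0; pose N r := \sum_j `|f j r|.
pose K : R := #|I|%:R; have K0 : 0 <= K by rewrite ler0n.
have KL0 : 0 <= K * L by exact: mulr_ge0.
have KL1 : 0 < 1 + K * L by rewrite ltr_pwDl.
pose e := Num.min d (1 + K * L)^-1 / 2.
have e0 : 0 < e by rewrite divr_gt0// lt_min d0 invr_gt0.
have ed : e <= d.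
  by rewrite /e ler_pdivrMr// (@le_trans _ _ d) ?ge_min ?lexx// ler_peMr ?ler1n ?ltW.
have KLe : K * L * e <= 1 / 2.
  rewrite /e mulrA ler_pM2r ?invr_gt0//.
  rewrite (@le_trans _ _ (K * L * (1 + K * L)^-1))//.
    by rewrite ler_wpM2l// ge_min lexx orbT.
  by rewrite ler_pdivrMr// mul1r lerDr.
exists e => // r0 r0e i0.
have se : s <= s + e by rewrite lerDl ltW.
have cN : {within `[s, s + e], continuous N}.
  apply/continuous_in_subspaceT => x /[1!inE] /=; rewrite in_itv/= => /andP[sx xe].
  rewrite (_ : N = \sum_j (fun r => `|f j r|)); last by rewrite fct_sumE.
  have cf j : {for x, continuous (fun r => `|f j r|)}.
    apply: cvg_norm; apply/differentiable_continuous/derivable1_diffP.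
    have [//] : is_derive x 1 (f j) (df j x).
    by apply: fdf; rewrite sx (le_trans xe)// lerD2l.
  elim/big_ind : _ => [|p q cp cq|j _]; last exact: cf.
    exact: cst_continuous.
  exact: continuousD.
have [c] := EVT_max se cN; rewrite in_itv/= => /andP[sc ce] Nc.
have N0 r : 0 <= N r by exact: sumr_ge0.
have fN i r : s <= r <= s + e -> `|f i r| <= L * e * N c.
  move=> /andP[sr re].
  have [x|x /andP[sx xr]] := @mean_value R (f i) (df i) s r sr.
    move=> /andP[sx xr]; apply: fdf.
    by rewrite sx (le_trans xr)// (le_trans re)// lerD2l.
  rewrite f0 subr0 => ->; rewrite normrM [`|r - s|]ger0_norm ?subr_ge0//.
  rewrite mulrAC ler_pM ?subr_ge0//; last by rewrite lerBlDl.
  have xe : x <= s + e by rewrite (le_trans xr).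
  rewrite (le_trans (dfL i x _)) ?sx ?(le_trans xe) ?lerD2l//.
  by rewrite ler_wpM2l// Nc// in_itv/= sx.
have : N c <= 1 / 2 * N c.
  apply: (@le_trans _ _ (K * L * e * N c)); last by rewrite ler_wpM2r.
  rewrite {1}/N (le_trans (ler_sum _ (fun i _ => fN i c _))) ?sc//.
  by rewrite sumr_const -[_ *+ _]mulr_natl -/K !mulrA.
move=> Nc2; have {Nc2} Nc0 : N c = 0 by have := N0 c; lra.
by apply/eqP; rewrite -normr_le0 (le_trans (fN i0 r0 r0e))// Nc0 mulr0.
Qed.

(* Solutions u and v of the same differential equation; the equation itself
   only enters through the Lipschitz comparison of the derivatives. *)
Lemma ode_unique (u v du dv : I -> R -> R) :
  (forall i (s : R), 0 <= s <= 1 -> is_derive s 1 (u i) (du i s)) ->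
  (forall i (s : R), 0 <= s <= 1 -> is_derive s 1 (v i) (dv i s)) ->
  (forall i, u i 0 = v i 0) ->
  (forall s : R, 0 <= s <= 1 -> (forall i, u i s = v i s) -> forall i,
     lip_near (fun r => \sum_j `|u j r - v j r|) s (du i) (dv i)) ->
  forall s : R, 0 <= s <= 1 -> forall i, u i s = v i s.
Proof.
move=> hu hv uv0 lip.
have huv i (s : R) : 0 <= s <= 1 ->
    is_derive s 1 (fun r => u i r - v i r) (du i s - dv i s).
  by move=> s01; have := hu i s s01 => h1; have := hv i s s01 => h2; apply: is_deriveB.
apply: unit_interval_induction => // [s /andP[s0 s1] uv i|s /andP[s0 s1] uv].
  apply/eqP; rewrite -subr_eq0; apply/eqP.
  apply: (@eq0_of_left R (fun r => u i r - v i r)) => //.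
    have [|+ _] := huv i s; first by rewrite s1 ltW.
    by move=> /derivable1_diffP/differentiable_continuous.
  by move=> r r0s; rewrite uv ?subrr.
have s01 : 0 <= s <= 1 by rewrite s0 ltW.
(* A constant is chosen for each component, so that their sum serves all of them; the default 0 is
   never reached, by [LP]. *)
pose L i := xget 0 [set L | 0 <= L /\ \forall r \near s,
  `|du i r - dv i r| <= L * \sum_j `|u j r - v j r|].
have LP i : 0 <= L i /\ \forall r \near s,
    `|du i r - dv i r| <= L i * \sum_j `|u j r - v j r|.
  have [M M0 HM] := lip_near_ge0 (lip s s01 uv i).
  apply: (@xgetPex _ 0 [set L | 0 <= L /\ \forall r \near s,
    `|du i r - dv i r| <= L * \sum_j `|u j r - v j r|]).
  by exists M; split => //; apply: filterS HM => r [].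
have : \forall r \near s, forall i,
    `|du i r - dv i r| <= L i * \sum_j `|u j r - v j r|.
  exact: (@filter_forall _ _ (fun i r => is_true
    (`|du i r - dv i r| <= L i * \sum_j `|u j r - v j r|)) _ _
    (fun i => (LP i).2)).
move=> /nbhs_ballP[d /= d0 dP].
pose d' := Num.min (d / 2) (1 - s).
have d'0 : 0 < d' by rewrite lt_min divr_gt0//= subr_gt0.
have d'd : d' <= d / 2 by rewrite ge_min lexx.
have d's : d' <= 1 - s by rewrite ge_min lexx orbT.
have [|i r /andP[sr rd]|i r /andP[sr rd]|i|e e0 eP] :=
  @eq0_of_deriv_le (fun i r => u i r - v i r) (fun i r => du i r - dv i r)
    s d' (\sum_i L i) d'0.
- by apply: sumr_ge0 => i _; have [] := LP i.
- by apply: huv; apply/andP; split; lra.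
- apply: (le_trans (dP r _ i)); first by rewrite /ball/= ler0_norm; lra.
  rewrite ler_wpM2r ?sumr_ge0// (bigD1 i)//= lerDl sumr_ge0// => j _.
  by have [] := LP j.
- by rewrite uv subrr.
- by exists e => // r /eP H i; apply/eqP; rewrite -subr_eq0 H.
Qed.

End OdeUniqueness.

(** * Local Lipschitz bounds and symmetry of second derivatives *)

Section SmoothFunctions.
Context (R : realType).
Implicit Types V W : normedModType R.

Lemma is_derive_line V (y v : V) (r : R) : is_derive r 1 (fun a => y + a *: v) v.
Proof.
have h : is_derive r 1 ( *:%R^~ v) v.
  apply: DeriveDef; first exact/derivable1_diffP.
  by rewrite deriveE// diff_val scale1r.
have := is_deriveD (is_derive_cst y r (1 : R^o)) h.
by rewrite add0r.
Qed.

(** Mean value theorem on the segment from [y] to [x], inside a ball where each partial derivative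
    exceeds its size at [x0] by at most 1. *)
Lemma smooth_on_lipschitz n m p (A : set 'cV[R]_n) (f : 'cV[R]_n -> 'M[R]_(m, p))
    x0 i j : open A -> smooth_on A f -> A x0 ->
  exists2 L, 0 <= L & exists2 d, 0 < d & forall x y, `|x0 - x| < d -> `|x0 - y| < d ->
    `|f x i j - f y i j| <= L * \sum_k `|x k 0 - y k 0|.
Proof.
move=> oA sf Ax0.
pose M k := `|('D_(delta_mx k 0) f x0) i j| + 1.
have M0 k : 0 <= M k by rewrite addr_ge0.
have near1 k : \forall x \near x0, `|('D_(delta_mx k 0) f x) i j| <= M k.
  have c : {for x0, continuous (fun x => ('D_(delta_mx k 0) f x) i j : R)}.
    apply: (@continuous_comp _ _ _ (fun x => 'D_(delta_mx k 0) f x)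
      (fun N : 'M[R]_(m, p) => N i j)).
      exact: smooth_on_continuous (smooth_on_derive _ sf) Ax0.
    exact: coord_continuous.
  by apply: cvgr_norm_le c _ _; rewrite ltrDl.
have nearA : \forall x \near x0, A x by exact: open_nbhs_nbhs.
have nearM : \forall x \near x0, forall k, `|('D_(delta_mx k 0) f x) i j| <= M k.
  exact: (@filter_forall _ _ (fun k x => is_true
    (`|('D_(delta_mx k 0) f x) i j| <= M k)) _ _ near1).
have /nbhs_ballP[d /= d0 dP] : \forall x \near x0, A x /\
    forall k, `|('D_(delta_mx k 0) f x) i j| <= M k by near=> x; split; near: x.
exists (\sum_k M k); first exact: sumr_ge0.
exists d => // x y xd yd.
pose z r := y + r *: (x - y).
have zd (r : R) : 0 <= r <= 1 -> ball x0 d (z r).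
  move=> /andP[r0 r1]; rewrite -ball_normE/=.
  rewrite (_ : x0 - z r = r *: (x0 - x) + (1 - r) *: (x0 - y)); last first.
    rewrite /z !scalerBr !scalerBl !scale1r.
    by apply/matrixP => a b; rewrite !mxE; ring.
  rewrite (le_lt_trans (ler_normD _ _))// !normrZ !ger0_norm ?subr_ge0//.
  have := xd; have := yd.
  set a := `|_ - y|; set b := `|_ - x|; move=> ad bd.
  (* At [r = 0] the point [x] has weight zero, and strictness comes from [y] instead. *)
  have [->|r0'] := eqVneq r 0; first by rewrite mul0r add0r subr0 mul1r.
  have {}r0 : 0 < r by rewrite lt_def r0'.
  apply: (@lt_le_trans _ _ (r * d + (1 - r) * a)).
    by rewrite ltrD2r ltr_pM2l.
  apply: (@le_trans _ _ (r * d + (1 - r) * d)).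
    by rewrite lerD2l ler_wpM2l ?subr_ge0// ltW.
  by rewrite -mulrDl subrKC mul1r.
have zD (r : R) : 0 <= r <= 1 ->
    is_derive r 1 (fun r => f (z r) i j) (('D_(x - y) f (z r)) i j).
  move=> r01; apply: is_derive_entry.
  apply: (@is_derive_along _ _ _ z f); first exact: is_derive_line.
  by apply: smooth_on_differentiable sf _; have [] := dP _ (zd r r01).
have [c /andP[c0 c1]] := mean_value ler01 zD.
rewrite /z scale1r scale0r addr0 subrKC subr0 mulr1 => ->.
have [Az zM] := dP _ (zd c (introT andP (conj c0 c1))).
rewrite (derive_basis _ (smooth_on_differentiable sf Az)).
rewrite summxE (le_trans (ler_norm_sum _ _ _))// mulr_sumr ler_sum// => k _.
rewrite !mxE normrM mulrC ler_wpM2r//.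
rewrite (le_trans (zM k))// (bigD1 k)//= lerDl sumr_ge0//.
Unshelve. all: by end_near. Qed.

Lemma lip_near_smooth n m p (A : set 'cV[R]_n) (f : 'cV[R]_n -> 'M[R]_(m, p))
    (C D : R -> 'cV[R]_n) (N : R -> R) s i j :
  open A -> smooth_on A f -> (forall r, 0 <= N r) ->
  {for s, continuous C} -> {for s, continuous D} -> C s = D s -> A (C s) ->
  (forall k r, `|C r k 0 - D r k 0| <= N r) ->
  lip_near N s (fun r => f (C r) i j) (fun r => f (D r) i j).
Proof.
move=> oA sf N0 cC cD CD AC CDN.
have [L L0 [d d0 Ld]] := smooth_on_lipschitz i j oA sf AC.
have cfC (E : R -> 'cV[R]_n) : {for s, continuous E} -> E s = C s ->
    {for s, continuous (fun r => f (E r) i j : R)}.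
  move=> cE EC; apply: (@continuous_comp _ _ _ (f \o E)
      (fun N : 'M[R]_(m, p) => N i j)); last exact: coord_continuous.
  by apply: continuous_comp => //; rewrite EC; exact: smooth_on_continuous AC.
pose F := `|f (C s) i j|.
(* [L * n%:R] bounds the difference, each of the [n] coordinates contributing at most [N r]; [F + 1]
   bounds the values near [s]. *)
pose M := L * n%:R + (F + 1).
have F0 : 0 <= F by exact: normr_ge0.
have Ln0 : 0 <= L * n%:R by exact: mulr_ge0.
have LM : L * n%:R <= M by rewrite /M; lra.
have FM : F < M by rewrite /M; lra.
exists M; near=> r; split.
- by near: r; apply: cvgr_norm_le (cfC C cC erefl) _ _.
- near: r; have := cfC D cD (esym CD) => c; apply: cvgr_norm_le c _ _.
  by rewrite -CD.
- apply: (@le_trans _ _ (L * n%:R * N r)); last exact: ler_wpM2r.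
  rewrite (le_trans (Ld _ _ _ _))//.
  + by near: r; have /cvgrPdist_lt := cC; exact.
  + by near: r; rewrite CD; have /cvgrPdist_lt := cD; exact.
  + rewrite -mulrA ler_wpM2l// (le_trans (ler_sum _ (fun k _ => CDN k r)))//.
    by rewrite sumr_const card_ord -[_ *+ _]mulr_natl.
Unshelve. all: by end_near. Qed.

(** Two mean value theorems give equal values at two unrelated nearby points; continuity then
    suffices. *)
Lemma eq_of_meeting V (f g : V -> R) (x : V) :
  {for x, continuous f} -> {for x, continuous g} ->
  (forall d, 0 < d -> exists y z, [/\ ball x d y, ball x d z & f y = g z]) ->
  f x = g x.
Proof.
move=> cf cg meet; apply/eqP; rewrite -subr_eq0 -normr_le0.
apply/ler_addgt0Pl => e e0; rewrite addr0.
have e20 : 0 < e / 2 by rewrite divr_gt0.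
have /cvgrPdist_le/(_ _ e20)/nbhs_ballP[d1 /= d10 f1] := cf.
have /cvgrPdist_le/(_ _ e20)/nbhs_ballP[d2 /= d20 g2] := cg.
have [|y [z [yd zd fg]]] := meet (Num.min d1 d2); first by rewrite lt_min d10.
have H1 : `|f x - f y| <= e / 2.
  by apply: f1; apply: le_ball yd; rewrite ge_min lexx.
have H2 : `|g x - g z| <= e / 2.
  by apply: g2; apply: le_ball zd; rewrite ge_min lexx orbT.
rewrite (_ : f x - g x = (f x - f y) - (g x - g z)); last by rewrite fg; ring.
by rewrite (le_trans (ler_normB _ _))// [leRHS]splitr lerD.
Qed.

Section Schwarz.
Context (V : normedModType R) (m p : nat) (A : set V) (F : V -> 'M[R]_(m, p)).
Hypotheses (oA : open A) (sF : smooth_on A F).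

(** Mean value theorem twice: in [a] for the increment of [F] along [h *: v], then in [b] for
    ['D_u F]. The left-hand side is symmetric in [u] and [v], which is what Schwarz's theorem
    exploits. *)
Lemma second_difference (x u v : V) (h : R) i j : 0 < h ->
  (forall a b : R, 0 <= a <= h -> 0 <= b <= h -> A (x + a *: u + b *: v)) ->
  exists a b, [/\ 0 <= a <= h, 0 <= b <= h &
    F (x + h *: u + h *: v) i j - F (x + h *: v) i j - (F (x + h *: u) i j - F x i j)
    = h * h * ('D_v (fun y => 'D_u F y) (x + a *: u + b *: v)) i j].
Proof.
move=> h0 Ah; pose P (a b : R) : V := x + a *: u + b *: v.
have h00 : 0 <= (0 : R) <= h by rewrite lexx ltW.
have hh : 0 <= h <= h by rewrite lexx ltW.
have dPa (a b : R) : is_derive a 1 (P^~ b) u.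
  rewrite (_ : P^~ b = fun a => (x + b *: v) + a *: u); first exact: is_derive_line.
  by apply/funext => ?; rewrite /P addrAC.
have dF (a b : R) : 0 <= a <= h -> 0 <= b <= h ->
    is_derive a 1 (fun a => F (P a b) i j) (('D_u F (P a b)) i j).
  move=> a0 b0; apply: is_derive_entry.
  apply: (@is_derive_along _ _ _ (P^~ b) F).
  exact: smooth_on_differentiable sF (Ah _ _ _ _).
have [a ah aE] := @mean_value R (fun a => F (P a h) i j - F (P a 0) i j)
  (fun a => ('D_u F (P a h)) i j - ('D_u F (P a 0)) i j) 0 h (ltW h0)
  (fun a ah => is_deriveB (dF a h ah hh) (dF a 0 ah h00)).
have dDF (b : R) : 0 <= b <= h -> is_derive b 1 (fun b => ('D_u F (P a b)) i j)
    (('D_v (fun y => 'D_u F y) (P a b)) i j).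
  move=> b0; apply: (@is_derive_entry R R^o _ _ (fun b => 'D_u F (P a b))).
  apply: (@is_derive_along _ _ _ (P a) (fun y => 'D_u F y)).
    exact: is_derive_line.
  exact: smooth_on_differentiable (smooth_on_derive _ sF) (Ah _ _ _ _).
have [b bh bE] := mean_value (ltW h0) dDF.
exists a, b; split=> //; rewrite subr0 in aE bE.
rewrite bE {1 2 3 4}/P !scale0r !addr0 in aE.
rewrite -/(P a b) [RHS]mulrC mulrA -aE; ring.
Qed.

Lemma derive_schwarz (x u v : V) : A x ->
  'D_u (fun y => 'D_v F y) x = 'D_v (fun y => 'D_u F y) x.
Proof.
move=> Ax; apply/matrixP => i j.
have cD u' v' : {for x, continuous
    (fun y => ('D_u' (fun y => 'D_v' F y) y) i j : R)}.
  apply: (@continuous_comp _ _ _ (fun y => 'D_u' (fun y => 'D_v' F y) y)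
    (fun N : 'M[R]_(m, p) => N i j)); last exact: coord_continuous.
  exact: smooth_on_continuous (smooth_on_derive _ (smooth_on_derive _ sF)) Ax.
apply: (eq_of_meeting (cD u v) (cD v u)) => d1 d10.
have [d [d0 dd1 dP]] : exists d, [/\ 0 < d, d <= d1 & ball x d `<=` A].
  have /nbhs_ballP[d /= d0 dP] : nbhs x A by exact: open_nbhs_nbhs.
  exists (Num.min d d1); split; first by rewrite lt_min d0.
    by rewrite ge_min lexx orbT.
  by move=> y yd; apply: dP; apply: le_ball yd; rewrite ge_min lexx.
(* With this [h] the parallelogram of sides [h *: u] and [h *: v] stays in the ball; the summand 1
   keeps [K] positive when [u] and [v] vanish. *)
pose K := 1 + `|u| + `|v|; have K0 : 0 < K by rewrite /K -addrA ltr_pwDl// addr_ge0.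
pose h := d / 2 / K; have h0 : 0 < h by rewrite /h !divr_gt0.
have hP (a b : R) : 0 <= a <= h -> 0 <= b <= h ->
    ball x d (x + a *: u + b *: v) /\ ball x d (x + a *: v + b *: u).
  move=> /andP[a0 ah] /andP[b0 bh]; rewrite -ball_normE/=.
  have hK : h * (`|u| + `|v|) < d.
    apply: (@le_lt_trans _ _ (h * K)).
      by rewrite ler_pM2l// /K -addrA lerDr.
    by rewrite /h divfK ?gt_eqF//; lra.
  have B (a' b' : R) (u' v' : V) : 0 <= a' <= h -> 0 <= b' <= h ->
      `|x - (x + a' *: u' + b' *: v')| <= h * (`|u'| + `|v'|).
    move=> /andP[? ?] /andP[? ?]; rewrite -addrA opprD addrA subrr add0r normrN.
    rewrite (le_trans (ler_normD _ _))// !normrZ !ger0_norm// mulrDr.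
    by rewrite lerD// ler_wpM2r.
  split; first by rewrite (le_lt_trans (B _ _ _ _ _ _))// ?a0 ?b0.
  by rewrite (le_lt_trans (B _ _ _ _ _ _)) ?a0 ?b0// addrC.
have [|a [b [ah bh E1]]] := @second_difference x u v h i j h0.
  by move=> a b ah bh; have [/dP] := hP a b ah bh.
have [|a' [b' [ah' bh' E2]]] := @second_difference x v u h i j h0.
  by move=> a' b' ah' bh'; have [_ /dP] := hP a' b' ah' bh'.
have [_ B2] := hP a' b' ah' bh'; have [B1 _] := hP a b ah bh.
exists (x + a' *: v + b' *: u), (x + a *: u + b *: v); split.
- exact: le_ball dd1 _ B2.
- exact: le_ball dd1 _ B1.
- have hh : h * h != 0 by rewrite mulf_neq0// gt_eqF.
  apply: (mulfI hh); apply: (etrans (esym E2)); apply: (etrans _ E1).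
  rewrite [x + h *: v + _]addrAC; ring.
Qed.

End Schwarz.
End SmoothFunctions.

(** * Jacobian and Hessian matrices *)

Section Jacobian.
Context (R : realType) (n m : nat).
Implicit Types f : 'cV[R]_n -> 'cV[R]_m.

(** For [Kmap X H x] at 0 this is convertible to [kmx X H x]. *)
Definition jac f t : 'M[R]_(m, n) :=
  \matrix_(i, j) ('D_(delta_mx j 0 : 'cV[R]_n) f t) i 0.

(** The second derivative with one slot filled by [v]: a matrix, so that the product rule for [*m]
    applies to [jac]. *)
Definition hess f v t : 'M[R]_(m, n) :=
  \matrix_(i, j) ('D_v (fun s => 'D_(delta_mx j 0 : 'cV[R]_n) f s) t) i 0.

Lemma derive_jac f t v : differentiable f t -> 'D_v f t = jac f t *m v.
Proof.
move=> df; rewrite derive_basis//; apply/matrixP => i j.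
rewrite summxE !mxE; apply: eq_bigr => k _.
by rewrite !mxE !ord1 mulrC.
Qed.

Context (f : 'cV[R]_n -> 'cV[R]_m) (A : set 'cV[R]_n).
Hypotheses (oA : open A) (sf : smooth_on A f).

Lemma is_derive_jac_comp (U : normedModType R) (c : U -> 'cV[R]_n) u w dc :
  differentiable c u -> 'D_w c u = dc -> A (c u) ->
  is_derive u w (fun z => jac f (c z)) (hess f dc (c u)).
Proof.
move=> dcu dcE Ac; apply: is_derive_mx => i j; rewrite mxE.
under [X in is_derive _ _ X _]eq_fun do rewrite mxE.
apply: is_derive_entry.
apply: (@is_derive_comp _ _ _ _ c (fun s => 'D_(delta_mx j 0) f s)) => //.
exact: smooth_on_differentiable (smooth_on_derive _ sf) Ac.
Qed.

Lemma is_derive_jac t u : A t -> is_derive t u (jac f) (hess f u t).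
Proof.
move=> At; apply: (@is_derive_jac_comp _ id t u u) => //; exact: derive_id.
Qed.

Lemma hess_mulmx u v t : A t -> hess f u t *m v = 'D_u (fun s => 'D_v f s) t.
Proof.
move=> At; have h1 := is_derive_jac u At.
have h2 := is_derive_mulmx h1 (is_derive_cst v t u).
have E : 'D_u (fun s => jac f s *m v) t = hess f u t *m v.
  by have [_ ->] := h2; rewrite mulmx0 addr0.
rewrite -E; apply: near_eq_derive; near=> s.
by rewrite derive_jac//; apply: smooth_on_differentiable sf _; near: s;
  exact: open_nbhs_nbhs.
Unshelve. all: by end_near. Qed.

Lemma hess_sym u v t : A t -> hess f u t *m v = hess f v t *m u.
Proof.
move=> At; have := derive_schwarz oA sf u v At.
by rewrite -(hess_mulmx u v At) -(hess_mulmx v u At).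
Qed.

End Jacobian.

(** * Calculus of a deformation: the derivatives of [phi], and torsion *)

Section DeformationCalculus.
Context (R : realType) (n : nat) (X : set 'cV[R]_n) (oX : open X).
Context (H : 'cV[R]_n -> 'cV[R]_n -> 'cV[R]_n) (dH : is_deformation X H).
Implicit Types (x y t v : 'cV[R]_n).

Lemma KmapK x v : X x -> shifts X x v -> Kmap X H x (H x v) = v.
Proof.
move=> Xx xv; have [_ injH _ _ _] := dH.
by apply: pinvKV; [exact: injH|rewrite inE].
Qed.

Lemma params_H x v : shifts X x v -> params X H x (H x v).
Proof. by move=> xv; exists v. Qed.

Lemma shifts_Kmap x t : X x -> params X H x t -> X (x + Kmap X H x t).
Proof. by move=> Xx [v xv <-]; rewrite KmapK. Qed.

Lemma deformationK x t : X x -> params X H x t -> H x (Kmap X H x t) = t.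
Proof. by move=> Xx [v xv <-]; rewrite KmapK. Qed.

Lemma deformation0 x : X x -> H x 0 = 0.
Proof. by have [+ _ _ _ _] := dH; exact. Qed.

Lemma shifts0 x : X x -> shifts X x 0.
Proof. by rewrite /shifts/= addr0. Qed.

Lemma params0 x : X x -> params X H x 0.
Proof. by move=> Xx; rewrite -(deformation0 Xx); apply/params_H/shifts0. Qed.

Lemma Kmap0 x : X x -> Kmap X H x 0 = 0.
Proof. by move=> Xx; rewrite -{1}(deformation0 Xx) KmapK//; exact: shifts0. Qed.

Lemma open_shifts x : open (shifts X x).
Proof.
apply: (@open_comp _ _ (fun v => x + v)) oX => v _.
by apply: continuousD; [exact: cst_continuous|exact: cvg_id].
Qed.

Lemma open_params x : X x -> open (params X H x).
Proof.
move=> Xx; have [_ _ _ oP _] := dH.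
have -> : params X H x = (fun t => (x, t)) @^-1`
    [set p : 'cV[R]_n * 'cV[R]_n | X p.1 /\ params X H p.1 p.2].
  by apply/seteqP; split=> t /=; [split|case].
apply: open_comp oP => t _; apply: differentiable_continuous.
exact: differentiable_pair.
Qed.

Lemma smooth_H x : X x -> smooth_on (shifts X x) (H x).
Proof.
move=> Xx; have [_ _ sH _ _] := dH.
suff <- : [set v | X x /\ shifts X x v] = shifts X x.
  exact: smooth_on_slice2 x sH.
by apply/seteqP; split=> t /=; [case|split].
Qed.

Lemma smooth_Kmap x : X x -> smooth_on (params X H x) (Kmap X H x).
Proof.
move=> Xx; have [_ _ _ _ sK] := dH.
suff <- : [set t | X x /\ params X H x t] = params X H x.
  exact: smooth_on_slice2 x sK.
by apply/seteqP; split=> t /=; [case|split].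
Qed.

Lemma differentiable_Kmap x t : X x -> params X H x t ->
  differentiable (Kmap X H x) t.
Proof. by move=> Xx; apply: smooth_on_differentiable (smooth_Kmap Xx). Qed.

Lemma derive_Kmap0 x v : X x -> 'D_v (Kmap X H x) 0 = kmx X H x *m v.
Proof.
by move=> Xx; rewrite derive_jac//; exact: (differentiable_Kmap Xx (params0 Xx)).
Qed.

Section Frame.
Context (e : 'cV[R]_n -> 'M[R]_n) (se : smooth_on X e).
Hypothesis (ke : forall x, X x -> kmx X H x = e x).

Lemma differentiable_translate x t : X x -> params X H x t ->
  differentiable (fun t => x + Kmap X H x t) t.
Proof.
by move=> Xx xt; apply: differentiableD => //; exact: differentiable_Kmap.
Qed.

Lemma derive_translate x t v : X x -> params X H x t ->
  'D_v (fun t => x + Kmap X H x t) t = 'D_v (Kmap X H x) t.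
Proof.
move=> Xx xt; rewrite (@deriveD _ _ _ (cst x))//; last first.
  exact/diff_derivable/differentiable_Kmap.
by rewrite derive_cst add0r.
Qed.

Lemma is_derive_phi x t v : X x -> params X H x t ->
  is_derive 0 v (fun t' => phi X H x t t')
    (jac (H x) (Kmap X H x t) *m (e (x + Kmap X H x t) *m v)).
Proof.
move=> Xx xt; set y := x + Kmap X H x t.
have Xy : X y by exact: shifts_Kmap.
have dc : differentiable (fun t' => Kmap X H x t + Kmap X H y t') 0.
  apply: differentiableD => //; exact: (differentiable_Kmap Xy (params0 Xy)).
have Dc : 'D_v (fun t' => Kmap X H x t + Kmap X H y t') 0 = e y *m v.
  rewrite (@deriveD _ _ _ (cst (Kmap X H x t)))//; last first.
    exact/diff_derivable/(differentiable_Kmap Xy (params0 Xy)).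
  by rewrite derive_cst add0r derive_Kmap0// ke.
have dHx : differentiable (H x) (Kmap X H x t).
  exact: smooth_on_differentiable (smooth_H Xx) (shifts_Kmap Xx xt).
have := @is_derive_comp R _ _ _ (fun t' => Kmap X H x t + Kmap X H y t') (H x)
  0 v _ dc Dc.
by rewrite Kmap0// addr0 derive_jac//; exact.
Qed.

(** [gamma] is a bare value of ['D]; its derivability comes from the closed formula of
    [is_derive_phi], valid near 0. *)
Lemma is_derive_phi_gamma x u v : X x ->
  is_derive 0 u (fun t => 'D_v (fun t' => phi X H x t t') 0) (gamma X H x u v).
Proof.
move=> Xx; apply: derivableP.
have P0 := params0 Xx.
apply: (@near_eq_derivable _ _ _ (fun t =>
    jac (H x) (Kmap X H x t) *m (e (x + Kmap X H x t) *m v))).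
  have oP := open_params Xx; near=> t.
  have Pt : params X H x t by near: t; exact: open_nbhs_nbhs.
  by have [_ ->] := is_derive_phi v Xx Pt.
have h1 : is_derive 0 u (fun t => jac (H x) (Kmap X H x t))
    (hess (H x) ('D_u (Kmap X H x) 0) (Kmap X H x 0)).
  apply: (is_derive_jac_comp (smooth_H Xx)) => //.
    exact: differentiable_Kmap.
  by rewrite Kmap0//; exact: shifts0.
have h2 : is_derive 0 u (fun t => e (x + Kmap X H x t))
    ('D_('D_u (Kmap X H x) 0) e (x + Kmap X H x 0)).
  apply: (@is_derive_comp _ _ _ _ (fun t => x + Kmap X H x t) e).
  - exact: differentiable_translate.
  - exact: derive_translate.
  - by apply: smooth_on_differentiable se _; rewrite Kmap0// addr0.
by have [] := is_derive_mulmx h1 (is_derive_mulmx h2 (is_derive_cst v 0 u)).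
Unshelve. all: by end_near. Qed.

Lemma jac_Kmap_H x t (w : 'cV[R]_n) : X x -> params X H x t ->
  jac (Kmap X H x) t *m (jac (H x) (Kmap X H x t) *m w) = w.
Proof.
move=> Xx xt; set v := Kmap X H x t.
have xv : shifts X x v by exact: shifts_Kmap.
have dHx : differentiable (H x) v by exact: smooth_on_differentiable (smooth_H Xx) xv.
have dK : differentiable (Kmap X H x) (H x v).
  by rewrite deformationK//; exact: differentiable_Kmap.
have := @is_derive_comp R _ _ _ (H x) (Kmap X H x) v w _ dHx erefl dK.
rewrite (derive_jac _ dK) (derive_jac _ dHx) deformationK// => -[_ <-].
transitivity ('D_w id v); last exact: derive_id.
apply: near_eq_derive; have oS := @open_shifts x; near=> u => /=.
by rewrite KmapK//; near: u; exact: open_nbhs_nbhs.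
Unshelve. all: by end_near. Qed.

(** [H] has disappeared from the right-hand side; [hess_gamma] is the derivative of this identity in
    [t] at 0. *)
Lemma jac_phi x t v : X x -> params X H x t ->
  jac (Kmap X H x) t *m 'D_v (fun t' => phi X H x t t') 0 =
  e (x + Kmap X H x t) *m v.
Proof.
by move=> Xx xt; have [_ ->] := is_derive_phi v Xx xt; rewrite jac_Kmap_H.
Qed.

Lemma derive_phi0 x v : X x -> 'D_v (fun t' => phi X H x 0 t') 0 = v.
Proof.
move=> Xx; have P0 := params0 Xx; have [_ ->] := is_derive_phi v Xx P0.
rewrite Kmap0// addr0 -ke// /kmx -/(jac _ _).
have dK := differentiable_Kmap Xx P0.
have dHx : differentiable (H x) (Kmap X H x 0).
  by apply: smooth_on_differentiable (smooth_H Xx) _; exact: shifts_Kmap.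
have := @is_derive_comp R _ _ _ (Kmap X H x) (H x) 0 v _ dK erefl dHx.
rewrite (derive_jac _ dK) (derive_jac _ dHx) Kmap0// => -[_ <-].
transitivity ('D_v id (0 : 'cV[R]_n)); last exact: derive_id.
apply: near_eq_derive; have oP := open_params Xx; near=> u => /=.
by rewrite deformationK//; near: u; exact: open_nbhs_nbhs.
Unshelve. all: by end_near. Qed.

Lemma hess_gamma x u v : X x ->
  hess (Kmap X H x) u 0 *m v + e x *m gamma X H x u v =
  'D_(e x *m u) e x *m v.
Proof.
move=> Xx; have P0 := params0 Xx; have oP := open_params Xx.
have dK := differentiable_Kmap Xx P0.
have h1 : is_derive 0 u (jac (Kmap X H x)) (hess (Kmap X H x) u 0).
  exact: is_derive_jac (smooth_Kmap Xx) _ _ P0.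
have [_] := is_derive_mulmx h1 (is_derive_phi_gamma u v Xx).
rewrite derive_phi0// -/(kmx X H x) [jac _ _](ke Xx) => <-.
have dex : differentiable e (x + Kmap X H x 0).
  by apply: smooth_on_differentiable se _; rewrite Kmap0// addr0.
have := @is_derive_comp R _ _ _ (fun t => x + Kmap X H x t) e 0 u _
  (differentiable_translate Xx P0) (derive_translate u Xx P0) dex.
rewrite derive_Kmap0// ke// Kmap0// addr0 => h2.
have [_] := is_derive_mulmx h2 (is_derive_cst v 0 u).
rewrite mulmx0 addr0 => <-; apply: near_eq_derive; near=> t.
by rewrite jac_phi//; near: t; exact: open_nbhs_nbhs.
Unshelve. all: by end_near. Qed.

(** The right-hand side is the Lie bracket of the fields [e u] and [e v], so deformations with the
    same frame have the same torsion. *)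
Lemma gamma_torsion x u v : X x ->
  e x *m (gamma X H x u v - gamma X H x v u) =
  'D_(e x *m u) e x *m v - 'D_(e x *m v) e x *m u.
Proof.
move=> Xx.
have sub (E : 'M[R]_n) (h1 h2 g1 g2 a b : 'cV[R]_n) : h1 = h2 ->
    h1 + E *m g1 = a -> h2 + E *m g2 = b -> E *m (g1 - g2) = a - b.
  by move=> -> <- <-; rewrite mulmxBr opprD addrACA subrr add0r.
exact: sub (hess_sym (open_params Xx) (smooth_Kmap Xx) u v (params0 Xx))
  (hess_gamma u v Xx) (hess_gamma v u Xx).
Qed.

End Frame.
End DeformationCalculus.

(** * Bilinear forms and the algebra of the Levi-Civita argument *)

Section EuclideanForms.
Context (R : realType) (n : nat).
Implicit Types (A B eta : 'M[R]_n) (u v w : 'cV[R]_n).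

Lemma bil_delta A i j : bil A (delta_mx i 0) (delta_mx j 0) = A i j.
Proof.
rewrite /bil trmx_delta -rowE.
rewrite -[delta_mx j 0]trmxK trmx_delta -[row i A]trmxK -trmx_mul -rowE.
by rewrite !mxE.
Qed.

Lemma bil_inj A B : (forall u v, bil A u v = bil B u v) -> A = B.
Proof. by move=> h; apply/matrixP => i j; rewrite -!bil_delta h. Qed.

Lemma bilC A u v : A^T = A -> bil A u v = bil A v u.
Proof.
move=> sA; rewrite /bil.
have -> : (u^T *m A *m v) 0 0 = (u^T *m A *m v)^T 0 0 by rewrite [RHS]mxE.
by rewrite !trmx_mul trmxK sA mulmxA.
Qed.

Lemma euclidean_unitmx eta : euclidean eta -> eta \in unitmx.
Proof.
move=> [_ pos]; rewrite -row_free_unit -kermx_eq0.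
apply/rowV0P => u /sub_kermxP uA; apply/eqP; apply: contraT => u0.
have := pos u^T; rewrite /bil trmxK uA mul0mx mxE ltxx.
by apply; rewrite -[0]trmx0 (inj_eq trmx_inj).
Qed.

(* The braid argument behind the uniqueness of the Levi-Civita connection:
   a trilinear form symmetric in its first two arguments and antisymmetric in
   its last two vanishes. *)
Lemma antisym_torsion_free_eq0 eta (D : 'cV[R]_n -> 'M[R]_n) :
  euclidean eta ->
  (forall u, (D u)^T *m eta + eta *m D u = 0) ->
  (forall u v, D u *m v = D v *m u) ->
  forall u v, D u *m v = 0.
Proof.
move=> [seta pos] anti sym u v.
pose B u v w := bil eta (D u *m v) w.
have B12 a b c : B a b c = B b a c by rewrite /B sym.
have B23 a b c : B a b c = - B a c b.
  rewrite /B [in RHS](bilC _ _ seta) /bil trmx_mul -!mulmxA.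
  have /eqP := anti a; rewrite addr_eq0 => /eqP E.
  by rewrite [(D a)^T *m _]mulmxA E mulNmx mulmxN mxE -!mulmxA.
have B0 a b c : B a b c = 0.
  (* Six alternating swaps lead back to [B a b c] after three changes of sign. *)
  have := B23 a b c; have := B12 a c b; have := B23 c a b.
  have := B12 c b a; have := B23 b c a; have := B12 b a c.
  lra.
apply/eqP; apply: contraT => /pos.
by rewrite -/(B u v _) B0 ltxx.
Qed.

End EuclideanForms.

(** * The connection as the derivative of the rotations [pi] *)

Section RotationDeformation.
Context (R : realType) (n : nat) (X : set 'cV[R]_n) (oX : open X).
Context (eta : 'M[R]_n) (Hb : 'cV[R]_n -> 'cV[R]_n -> 'cV[R]_n).
Context (pi : 'cV[R]_n -> 'cV[R]_n -> 'M[R]_n).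
Hypotheses (dHb : is_deformation X Hb).
Hypothesis (rpi : is_rotation_deformation X eta Hb pi).
Implicit Types (x u v t : 'cV[R]_n).

Lemma smooth_rotation x : X x -> smooth_on (params X Hb x) (pi x).
Proof.
move=> Xx; have [spi _ _] := rpi.
suff <- : [set t | X x /\ params X Hb x t] = params X Hb x.
  exact: smooth_on_slice2 x spi.
by apply/seteqP; split=> t /=; [case|split].
Qed.

Lemma differentiable_rotation x t : X x -> params X Hb x t ->
  differentiable (pi x) t.
Proof. by move=> Xx; apply: smooth_on_differentiable (smooth_rotation Xx). Qed.

(** Joint smoothness of [pi] is essential: the derivative in direction [(0, u)] is taken on pairs
    and only then restricted to [t = 0]. The differential equation needs these coefficients to be
    smooth in [x]. *)
Lemma smooth_connection u : smooth_on X (fun x => 'D_u (pi x) 0).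
Proof.
have [spi _ _] := rpi.
have E : [set x | X x /\ params X Hb x 0] = X.
  apply/seteqP; split=> x /= => [[]//|Xx].
  by split=> //; exact: (params0 dHb).
pose Pi (p : 'cV[R]_n * 'cV[R]_n) := pi p.1 p.2.
have -> : (fun x => 'D_u (pi x) 0) =
    (fun x => 'D_((0, u) : 'cV[R]_n * 'cV[R]_n) Pi (x, 0)).
  by apply/funext => x; exact: (derive_slice2 Pi).
have : smooth_on [set x | X x /\ params X Hb x 0]
    (fun x => 'D_((0, u) : 'cV[R]_n * 'cV[R]_n) Pi (x, 0)).
  exact: (smooth_on_slice1 0 (smooth_on_derive _ spi)).
by rewrite E.
Qed.

Lemma connection_basis x u : X x ->
  'D_u (pi x) 0 = \sum_j u j 0 *: 'D_(delta_mx j 0) (pi x) 0.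
Proof.
move=> Xx; apply: derive_basis.
exact: (differentiable_rotation Xx (params0 dHb Xx)).
Qed.

Lemma is_derive_connection x u : X x -> is_derive 0 u (pi x) ('D_u (pi x) 0).
Proof.
move=> Xx; apply/derivableP/diff_derivable.
exact: (differentiable_rotation Xx (params0 dHb Xx)).
Qed.

Lemma connection_antisym x u : X x ->
  ('D_u (pi x) 0)^T *m eta + eta *m 'D_u (pi x) 0 = 0.
Proof.
move=> Xx; have [_ eta_pi pi0] := rpi.
have d := is_derive_connection u Xx; set G := 'D_u (pi x) 0 in d *.
have dT : is_derive 0 u (fun t => (pi x t)^T) G^T.
  apply: is_derive_mx => i j; rewrite mxE.
  under [X in is_derive _ _ X _]eq_fun do rewrite mxE.
  exact: is_derive_entry.
have [_] := is_derive_mulmx (is_derive_mulmx dT (is_derive_cst eta 0 u)) d.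
rewrite pi0// trmx1 mulmx1 !mul1mx addr0 => <-.
transitivity ('D_u (cst eta) (0 : 'cV[R]_n)); last exact: derive_cst.
apply: near_eq_derive; have oP := open_params dHb Xx; near=> t.
rewrite eta_pi//; near: t; apply: open_nbhs_nbhs; split => //.
exact: (params0 dHb).
Unshelve. all: by end_near. Qed.

Lemma rotation_unitmx x t : euclidean eta -> X x -> params X Hb x t ->
  pi x t \in unitmx.
Proof.
move=> /euclidean_unitmx ueta Xx xt; have [_ eta_pi _] := rpi.
have : (pi x t)^T *m eta *m pi x t \in unitmx by rewrite eta_pi.
by rewrite unitmx_mul => /andP[].
Qed.

End RotationDeformation.

(** * Canonical curves satisfy the geodesic equation *)

Section CanonicalCurves.
Context (R : realType) (n : nat) (X : set 'cV[R]_n) (oX : open X).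
Context (H : 'cV[R]_n -> 'cV[R]_n -> 'cV[R]_n) (dH : is_deformation X H).
Implicit Types (a b s : R) (c : R -> 'cV[R]_n).

(** The condition speaks of parameters at the starting point; applying [Kmap X H x] to it turns it
    into a step from an arbitrary point [c s] of the curve. *)
Lemma canonical_step a b c (tau : R -> 'cV[R]_n) (x := c 0) :
  X x ->
  (forall s s', s \in `]a, b[ -> s + s' \in `]a, b[ ->
    [/\ composable X H x (s *: tau 0) (s' *: tau s),
        c s = x + Kmap X H x (s *: tau 0) &
        phi X H x (s *: tau 0) (s' *: tau s) = (s + s') *: tau 0]) ->
  forall s s', s \in `]a, b[ -> s + s' \in `]a, b[ ->
    params X H (c s) (s' *: tau s) /\
    c (s + s') = c s + Kmap X H (c s) (s' *: tau s).
Proof.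
move=> Xx can s s' sab ss'ab.
have [[P1 P2] cs E] := can s s' sab ss'ab; rewrite -cs in P2.
split=> //.
have Xcs : X (c s) by rewrite cs; exact: (shifts_Kmap dH).
(* The instance with zero second parameter only serves to locate [c (s + s')]. *)
have [|_ -> _] := can (s + s') 0 ss'ab; first by rewrite addr0.
rewrite -E /phi -cs (KmapK dH)//.
  by rewrite addrA -cs.
by rewrite /shifts/= addrA -cs; exact: (shifts_Kmap dH).
Qed.

Section VelocityEquation.
Context (eta : 'M[R]_n) (g e : 'cV[R]_n -> 'M[R]_n).
Hypotheses (euc : euclidean eta) (rg : riemannian_metric X g).
Hypothesis (fe : orthonormal_frame X eta g e).
Hypothesis (ke : forall x, X x -> kmx X H x = e x).
Context (a b : R) (c : R -> 'cV[R]_n).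
Hypothesis (cc : canonical_curve X H a b c).
Let tau := velocity X H c.

(** Orthonormality reads e^T g e = eta. The inverse thus becomes a product of differentiable
    factors, and velocities can be differentiated without differentiating a matrix inverse. *)
Lemma invmx_frame x : X x -> invmx (e x) = invmx eta *m (e x)^T *m g x.
Proof.
move=> Xx; have [_ ue on] := fe.
have E : (e x)^T *m g x *m e x = eta.
  by apply: bil_inj => u v; rewrite -(on x Xx) /bil trmx_mul !mulmxA.
rewrite -[RHS](mulmxK (ue x Xx)) -[_ *m g x]mulmxA -[_ *m e x]mulmxA E.
by rewrite mulVmx ?euclidean_unitmx// mul1mx.
Qed.

Lemma near_itv s : s \in `]a, b[ -> \forall r \near s, r \in `]a, b[.
Proof. by move=> sab; apply: near_in_itvoo. Qed.

Lemma is_derive_curve s : s \in `]a, b[ -> is_derive s 1 c (e (c s) *m tau s).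
Proof.
move=> sab; have [[_ sc Xc] _] := cc; have [_ ue _] := fe.
rewrite /tau /velocity /hmx ke ?mulKVmx ?ue//; try exact: Xc.
rewrite derive1E; apply/derivableP/derivable1_diffP.
exact: smooth_on_differentiable sc sab.
Qed.

Lemma derivable_velocity s : s \in `]a, b[ -> derivable tau s 1.
Proof.
move=> sab; have [[_ sc Xc] _] := cc; have [se _ _] := fe; have [sg _] := rg.
apply: (@near_eq_derivable _ _ _
    (fun r => invmx eta *m (e (c r))^T *m g (c r) *m 'D_1 c r)).
  near=> r; have rab : r \in `]a, b[ by near: r; exact: near_itv.
  by rewrite /tau /velocity /hmx ke ?invmx_frame ?derive1E//; exact: Xc.
have dc := is_derive_curve sab.
have de := is_derive_along dc (smooth_on_differentiable se (Xc s sab)).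
have dg := is_derive_along dc (smooth_on_differentiable sg (Xc s sab)).
have dcc : is_derive s 1 (fun r => 'D_1 c r) ('D_1 (fun r => 'D_1 c r) s).
  apply/derivableP/derivable1_diffP.
  exact: smooth_on_differentiable (smooth_on_derive _ sc) sab.
have deT : is_derive s 1 (fun r => (e (c r))^T)
    ('D_(e (c s) *m tau s) e (c s))^T.
  apply: is_derive_mx => i j; rewrite mxE.
  under [X in is_derive _ _ X _]eq_fun do rewrite mxE.
  exact: is_derive_entry.
have h1 := is_derive_mulmx (is_derive_cst (invmx eta) s (1 : R^o)) deT.
by have [] := is_derive_mulmx (is_derive_mulmx h1 dg) dcc.
Unshelve. all: by end_near. Qed.

Lemma curve_step s s' : s \in `]a, b[ -> s + s' \in `]a, b[ ->
  params X H (c s) (s' *: tau s) /\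
  c (s + s') = c s + Kmap X H (c s) (s' *: tau s).
Proof.
have [[/andP[a0 b0] _ Xc] can] := cc; apply: canonical_step => //.
by apply: Xc; rewrite in_itv/= a0.
Qed.

(* The acceleration of the curve at y = c s is the second derivative of K_y,
   which hess_gamma expresses through e and gamma. *)
Lemma is_derive_velocity s : s \in `]a, b[ ->
  is_derive s 1 tau (- gamma X H (c s) (tau s) (tau s)).
Proof.
move=> sab; have [[_ sc Xc] _] := cc; have [se ue _] := fe.
set y := c s; have Xy : X y by exact: Xc.
have dtau := derivableP (derivable_velocity sab).
suff <- : 'D_1 tau s = - gamma X H y (tau s) (tau s) by [].
have dc := is_derive_curve sab.
have de := is_derive_along dc (smooth_on_differentiable se Xy).
have [_ L] := is_derive_mulmx de dtau.
have line (r : R) : is_derive r 1 (fun r : R => (r - s) *: tau s) (tau s).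
  rewrite (_ : (fun r => _) = fun r => (- (s *: tau s)) + r *: tau s).
    exact: is_derive_line.
  by apply/funext => r'; rewrite scalerBl addrC.
have dl (r : R) : differentiable (fun r : R => (r - s) *: tau s) r.
  by apply/derivable1_diffP; have [] := line r.
have P0 : params X H y ((s - s) *: tau s).
  by rewrite subrr scale0r; exact: (params0 dH).
have [_ Rr] := is_derive_mulmx
  (is_derive_jac_comp (smooth_Kmap dH Xy) (dl s) (@derive_val _ _ _ _ _ _ _ (line s)) P0)
  (is_derive_cst (tau s) s (1 : R^o)).
(* Near [s] both functions are the derivative of [c], once through the frame and once through the
   step from [y]. *)
have E : 'D_1 (fun r => e (c r) *m tau r) s =
    'D_1 (fun r => jac (Kmap X H y) ((r - s) *: tau s) *m tau s) s.
  apply: near_eq_derive; near=> r.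
  have rab : r \in `]a, b[ by near: r; exact: near_itv.
  have [_ <-] := is_derive_curve rab.
  have Pr : params X H y ((r - s) *: tau s).
    by have [|//] := @curve_step s (r - s) sab _; rewrite subrKC.
  rewrite -derive_jac; last exact: (differentiable_Kmap dH Xy Pr).
  rewrite -(derive_translate dH _ Xy Pr).
  have [_ <-] := is_derive_along (line r) (differentiable_translate dH Xy Pr).
  apply: near_eq_derive; near=> r'.
  have r'ab : r' \in `]a, b[ by near: r'; exact: near_itv.
  have [|_] := @curve_step s (r' - s) sab _; first by rewrite subrKC.
  by rewrite subrKC.
have hg := hess_gamma oX dH se ke (tau s) (tau s) Xy.
(* [D] is the derivative of the frame along the curve and [h] the Hessian term; both cancel, leaving
   M (d + gam) = 0. *)
have alg (M : 'M[R]_n) (D h d gam : 'cV[R]_n) : M \in unitmx ->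
    D + M *m d = h -> h + M *m gam = D -> d = - gam.
  move=> uM <-; rewrite -addrA -mulmxDr => /(canRL (addKr _)).
  rewrite addNr => /(congr1 (mulmx (invmx M))); rewrite mulKmx// mulmx0.
  by move/eqP; rewrite addr_eq0 => /eqP.
apply: (alg _ _ _ _ _ (ue y Xy) _ hg).
rewrite -L E Rr mulmx0 addr0 subrr scale0r.
by [].
Unshelve. all: by end_near. Qed.

End VelocityEquation.
End CanonicalCurves.

(** * Uniqueness for the geodesic and transport equations *)

Section TransportUniqueness.
Context (R : realType) (n : nat).

(** The connection enters through its values [Gam j] on basis vectors, so that every coordinate of
    the right-hand sides is a combination of sums and products that [lip_near] can follow. *)
Definition transport_eqs (e : 'cV[R]_n -> 'M[R]_n)
    (Gam : 'I_n -> 'cV[R]_n -> 'M[R]_n) (C T : R -> 'cV[R]_n)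
    (P : R -> 'M[R]_n) (r : R) : Prop :=
  let G := \sum_j T r j 0 *: Gam j (C r) in
  [/\ is_derive r 1 C (e (C r) *m T r),
      is_derive r 1 T (- (G *m T r)) &
      is_derive r 1 P (P r *m G)].

(** Flattens position, velocity and rotation into one family of reals over a finite type, as
    [ode_unique] expects. *)
Definition coords (x u : 'cV[R]_n) (p : 'M[R]_n)
    (i : 'I_n + 'I_n + 'I_n * 'I_n) : R :=
  match i with
  | inl (inl k) => x k 0
  | inl (inr k) => u k 0
  | inr kl => p kl.1 kl.2
  end.

Lemma is_derive_coords (C T : R -> 'cV[R]_n) (P : R -> 'M[R]_n) dC dT dP (r : R) i :
  is_derive r 1 C dC -> is_derive r 1 T dT -> is_derive r 1 P dP ->
  is_derive r 1 (fun r => coords (C r) (T r) (P r) i) (coords dC dT dP i).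
Proof. by move=> hC hT hP; case: i => [[k|k]|[k l]]; exact: is_derive_entry. Qed.

Lemma transport_unique (X : set 'cV[R]_n) e Gam (C1 T1 C2 T2 : R -> 'cV[R]_n)
    (P1 P2 : R -> 'M[R]_n) :
  open X -> smooth_on X e -> (forall j, smooth_on X (Gam j)) ->
  (forall r : R, 0 <= r <= 1 -> X (C1 r) /\ X (C2 r)) ->
  (forall r : R, 0 <= r <= 1 -> transport_eqs e Gam C1 T1 P1 r) ->
  (forall r : R, 0 <= r <= 1 -> transport_eqs e Gam C2 T2 P2 r) ->
  C1 0 = C2 0 -> T1 0 = T2 0 -> P1 0 = P2 0 ->
  C1 1 = C2 1 /\ P1 1 = P2 1.
Proof.
move=> oX se sG XC E1 E2 C0 T0 P0.
pose G (C T : R -> 'cV[R]_n) r := \sum_j T r j 0 *: Gam j (C r).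
pose u i r := coords (C1 r) (T1 r) (P1 r) i.
pose v i r := coords (C2 r) (T2 r) (P2 r) i.
pose du i r := coords (e (C1 r) *m T1 r) (- (G C1 T1 r *m T1 r))
  (P1 r *m G C1 T1 r) i.
pose dv i r := coords (e (C2 r) *m T2 r) (- (G C2 T2 r *m T2 r))
  (P2 r *m G C2 T2 r) i.
have hu i (r : R) : 0 <= r <= 1 -> is_derive r 1 (u i) (du i r).
  by move=> /E1[? ? ?]; exact: is_derive_coords.
have hv i (r : R) : 0 <= r <= 1 -> is_derive r 1 (v i) (dv i r).
  by move=> /E2[? ? ?]; exact: is_derive_coords.
have uv0 i : u i 0 = v i 0 by rewrite /u /v C0 T0 P0.
have [|C1E P1E] : (forall i, u i 1 = v i 1) -> C1 1 = C2 1 /\ P1 1 = P2 1.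
- move=> uv; split; apply/matrixP => k l.
    by rewrite ord1; exact: (uv (inl (inl k))).
  exact: (uv (inr (k, l))).
- move=> i; apply: (ode_unique hu hv uv0) => [s s01 uv {}i|]; last first.
    by rewrite ler01 lexx.
  set N := fun r => \sum_j `|u j r - v j r|.
  have N0 r : 0 <= N r by exact: sumr_ge0.
  have uvN j r : `|u j r - v j r| <= N r.
    by rewrite /N (bigD1 j)//= lerDl sumr_ge0.
  have cont (f : R -> R) df : is_derive s 1 f df -> {for s, continuous f}.
    by move=> [d _]; apply/differentiable_continuous/derivable1_diffP.
  have lcoord j : lip_near N s (u j) (v j).
    by apply: lip_near_coord => //; [exact: cont (hu j s s01)|exact: cont (hv j s s01)].
  have lC m p (f : 'cV[R]_n -> 'M[R]_(m, p)) k l : smooth_on X f ->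
      lip_near N s (fun r => f (C1 r) k l) (fun r => f (C2 r) k l).
    move=> sf; have [XC1 _] := XC s s01.
    have [dC1 _ _] := E1 s s01; have [dC2 _ _] := E2 s s01.
    apply: (lip_near_smooth _ _ oX sf N0) => //.
    + by apply/differentiable_continuous/derivable1_diffP; have [] := dC1.
    + by apply/differentiable_continuous/derivable1_diffP; have [] := dC2.
    + by apply/matrixP => i' j'; rewrite ord1; exact: (uv (inl (inl i'))).
    + by move=> j r; exact: (uvN (inl (inl j))).
  have lG k l : lip_near N s (fun r => G C1 T1 r k l) (fun r => G C2 T2 r k l).
    rewrite /G; under eq_fun do rewrite summxE; under [X in lip_near _ _ _ X]eq_fun do rewrite summxE.
    apply: lip_near_sum => j.
    under eq_fun do rewrite mxE; under [X in lip_near _ _ _ X]eq_fun do rewrite mxE.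
    by apply: lip_nearM => //; [exact: (lcoord (inl (inr j)))|exact: lC].
  rewrite /du /dv; case: i => [[k|k]|[k l]] /=.
  + under eq_fun do rewrite mxE; under [X in lip_near _ _ _ X]eq_fun do rewrite mxE.
    apply: lip_near_sum => j; apply: lip_nearM => //; first exact: lC.
    exact: (lcoord (inl (inr j))).
  + under eq_fun do rewrite 2!mxE; under [X in lip_near _ _ _ X]eq_fun do rewrite 2!mxE.
    apply: lip_nearN; apply: lip_near_sum => j; apply: lip_nearM => //.
    exact: (lcoord (inl (inr j))).
  + under eq_fun do rewrite mxE; under [X in lip_near _ _ _ X]eq_fun do rewrite mxE.
    apply: lip_near_sum => j; apply: lip_nearM => //.
    exact: (lcoord (inr (k, j))).
- by [].
Qed.

Lemma is_derive_rescale (V : normedModType R) (f : R -> V) (k r : R) df :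
  is_derive (r * k) 1 f df -> is_derive r 1 (fun r => f (r * k)) (k *: df).
Proof.
move=> [dfr <-]; have /derivable1_diffP d := dfr.
have line : is_derive r 1 (fun r : R => r * k) k.
  have h := is_deriveM (is_derive_id r (1 : R^o)) (is_derive_cst (k : R^o) r (1 : R^o)).
  apply: is_derive_eq h _; by rewrite /GRing.scale/= mulr0 add0r mulr1.
have := is_derive_along line d.
by rewrite !deriveE// -[k in 'd f _ k]mulr1 linearZ.
Qed.

End TransportUniqueness.

(** * Parallel transports: comparison of two groups with the same frame *)

Section ParallelTransports.
Context (R : realType) (n : nat) (X : set 'cV[R]_n) (oX : open X).
Context (eta : 'M[R]_n) (g e : 'cV[R]_n -> 'M[R]_n).
Hypotheses (euc : euclidean eta) (rg : riemannian_metric X g).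
Hypothesis (fe : orthonormal_frame X eta g e).

Section Flow.
Context (H Hb : 'cV[R]_n -> 'cV[R]_n -> 'cV[R]_n).
Context (pi : 'cV[R]_n -> 'cV[R]_n -> 'M[R]_n).
Hypotheses (dp : is_DP X eta H Hb pi) (ke : forall x, X x -> kmx X H x = e x).

(** The rotation component of the product is pi(t) pi(t') pi(t'')^-1, with a true inverse because
    [pi] preserves [eta]; its triviality makes [pi] multiplicative along the curve. *)
Lemma rotation_step x t t' : X x -> params X Hb x t ->
  params X Hb x (phi X Hb x t t') ->
  (dmul X Hb pi x (t, 1%:M) (t', 1%:M)).2 = 1%:M ->
  pi x (phi X Hb x t t') = pi x t *m pi (x + Kmap X Hb x t) t'.
Proof.
move=> Xx xt xt' /=; have [[_ dHb rpi _ _] _] := dp.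
have u := rotation_unitmx rpi euc Xx xt'.
by rewrite mul1mx mulmx1 => /(canRL (mulmxKV u)); rewrite mul1mx.
Qed.

(* Every parameter t is reached along a curve of the canonicity condition,
   rescaled here so that it reaches t at time 1; in particular the domain of
   the parameters at x is star-shaped. *)
Lemma transport_to x t : X x -> params X Hb x t ->
  exists C T : R -> 'cV[R]_n, T 0 = t /\ forall r : R, 0 <= r <= 1 ->
    [/\ X (C r), params X Hb x (r *: t), C r = x + Kmap X Hb x (r *: t) &
        transport_eqs e (fun j x => 'D_(delta_mx j 0) (pi x) 0) C T
          (fun r => pi x (r *: t)) r].
Proof.
move=> Xx xt; have [[[dH _] dHb rpi kk cons] curves] := dp.
have [a [b [c [cc c0 [k kab ck] can]]]] := curves x _ Xx (shifts_Kmap dHb Xx xt).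
have [[/andP[a0 b0] _ Xc] _] := cc.
set tau := velocity X H c in can.
have zab : 0 \in `]a, b[ by rewrite in_itv/= a0.
(* Both parameters translate [x] to [c k], and [Kmap X Hb x] is injective on parameters. *)
have tE : t = k *: tau 0.
  have [|[P1 _] ck' _] := can k 0 kab; first by rewrite addr0.
  rewrite -(deformationK dHb Xx xt) -(deformationK dHb Xx P1); congr (Hb x _).
  by apply: (addrI x); rewrite -ck -ck'.
(* The time [k] may be negative; the interval contains 0 and [k], hence all times between them. *)
have rab (r : R) : 0 <= r <= 1 -> r * k \in `]a, b[.
  move: kab; rewrite !in_itv/= => /andP[ak kb] /andP[r0 r1].
  have [k0|/ltW k0] := leP 0 k.
    have := mulr_ge0 r0 k0; have : 0 <= (1 - r) * k by rewrite mulr_ge0 ?subr_ge0.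
    by move=> *; apply/andP; split; lra.
  have := mulr_ge0_le0 r0 k0.
  have : (1 - r) * k <= 0 by rewrite mulr_ge0_le0 ?subr_ge0.
  by move=> *; apply/andP; split; lra.
have step s s' : s \in `]a, b[ -> s + s' \in `]a, b[ ->
    [/\ params X Hb (c s) (s' *: tau s), params X Hb x (s *: tau 0),
        c s = x + Kmap X Hb x (s *: tau 0) &
        pi x ((s + s') *: tau 0) = pi x (s *: tau 0) *m pi (c s) (s' *: tau s)].
  move=> sab ssab; have [[P1 P2] cs /pair_equal_spec[E1 E2]] := can s s' sab ssab.
  have [|[P3 _] _ _] := can (s + s') 0 ssab; first by rewrite addr0.
  split; [by rewrite {1}cs|exact: P1|exact: cs|].
  rewrite -E1 {1}cs; apply: (rotation_step Xx P1 _ E2).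
  by rewrite E1.
exists (fun r => c (r * k)), (fun r => k *: tau (r * k)); split.
  by rewrite mul0r tE.
move=> r r01; have sab := rab r r01; set s := r * k in sab *.
have Xy : X (c s) by exact: Xc.
have rt r' : r' *: t = (r' * k) *: tau 0 by rewrite tE scalerA.
have [|_ Ps cs _] := step s 0 sab; first by rewrite addr0.
split=> //; rewrite ?rt//.
have lin : \sum_j (k *: tau s) j 0 *: 'D_(delta_mx j 0) (pi (c s)) 0 =
    k *: 'D_(tau s) (pi (c s)) 0.
  rewrite (connection_basis dHb rpi)// scaler_sumr; apply: eq_bigr => j _.
  by rewrite mxE scalerA.
have eqC := is_derive_curve fe ke cc sab.
have eqT := is_derive_velocity oX dH euc rg fe ke cc sab.
(* By [step], near [s] the rotation is a constant factor times [pi (c s)] on a line that passes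
   through 0 at time [s]. *)
have eqP : is_derive s 1 (fun r => pi x (r *: tau 0))
    (pi x (s *: tau 0) *m 'D_(tau s) (pi (c s)) 0).
  have line : is_derive s 1 (fun r : R => (r - s) *: tau s) (tau s).
    rewrite (_ : (fun r => _) = fun r => (- (s *: tau s)) + r *: tau s).
      exact: is_derive_line.
    by apply/funext => r'; rewrite scalerBl addrC.
  have d0 : differentiable (pi (c s)) ((s - s) *: tau s).
    rewrite subrr scale0r; exact: (differentiable_rotation rpi Xy (params0 dHb Xy)).
  have := is_derive_mulmx (is_derive_cst (pi x (s *: tau 0)) s (1 : R^o))
    (is_derive_along line d0).
  rewrite mul0mx add0r subrr scale0r; apply: near_eq_is_derive; near=> r'.
  have r'ab : r' \in `]a, b[ by near: r'; exact: near_itv.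
  have [|_ _ _] := step s (r' - s) sab; first by rewrite subrKC.
  by rewrite subrKC => ->.
rewrite /transport_eqs lin; split.
- by rewrite -scalemxAr; exact: (is_derive_rescale eqC).
(* The acceleration is quadratic in the velocity: one factor [k] comes from [T], the other from the
   rescaled time. *)
- rewrite -scalemxAl -scalemxAr cons// -!scalerN.
  have h := is_derive_rescale eqT.
  exact: is_deriveZ.
- rewrite -scalemxAr rt; under eq_fun do rewrite rt.
  exact: (is_derive_rescale eqP).
Unshelve. all: by end_near. Qed.

End Flow.

Context (H1 Hb1 H2 Hb2 : 'cV[R]_n -> 'cV[R]_n -> 'cV[R]_n).
Context (pi1 pi2 : 'cV[R]_n -> 'cV[R]_n -> 'M[R]_n).
Hypotheses (dp1 : is_DP X eta H1 Hb1 pi1) (dp2 : is_DP X eta H2 Hb2 pi2).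
Hypotheses (ke1 : forall x, X x -> kmx X H1 x = e x).
Hypotheses (ke2 : forall x, X x -> kmx X H2 x = e x).

Lemma connection_unique x u : X x -> 'D_u (pi1 x) 0 = 'D_u (pi2 x) 0.
Proof.
move=> Xx; have [se ue _] := fe.
have [[[dH1 _] dHb1 rpi1 _ cons1] _] := dp1.
have [[[dH2 _] dHb2 rpi2 _ cons2] _] := dp2.
pose D (w : 'cV[R]_n) : 'M[R]_n := 'D_w (pi1 x) 0 - 'D_w (pi2 x) 0.
have D0 : forall w v : 'cV[R]_n, D w *m v = 0.
  apply: (@antisym_torsion_free_eq0 _ _ eta D euc) => [w|w v].
    rewrite /D linearB/= mulmxBl mulmxBr addrACA -opprD.
    by rewrite (connection_antisym dHb1 rpi1)// (connection_antisym dHb2 rpi2)// subrr.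
  have alg (M : 'M[R]_n) (a1 b1 a2 b2 d : 'cV[R]_n) : M \in unitmx ->
      M *m (a1 - b1) = d -> M *m (a2 - b2) = d -> a1 - a2 = b1 - b2.
    move=> uM <- /(congr1 (mulmx (invmx M))); rewrite !mulKmx// => E.
    apply/matrixP => i j; have := congr1 (fun A : 'cV[R]_n => A i j) E.
    by rewrite !mxE => ?; lra.
  have gamD w' v' : D w' *m v' = gamma X H1 x w' v' - gamma X H2 x w' v'.
    rewrite mulmxBl; congr (_ - _); [exact: cons1|exact: cons2].
  rewrite [LHS]gamD [RHS]gamD.
  exact: alg (ue x Xx) (gamma_torsion oX dH1 se ke1 w v Xx)
    (gamma_torsion oX dH2 se ke2 w v Xx).
apply/eqP; rewrite -subr_eq0 -/(D u); apply/eqP/matrixP => i j.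
have := congr1 (fun M : 'cV[R]_n => M i 0) (D0 u (delta_mx j 0)).
by rewrite -colE !mxE.
Qed.

(** Both solutions start from the data x, t, 1; at time 1 their positions give [Kmap] and their
    rotations give [pi]. *)
Lemma transports_agree x t : X x -> params X Hb1 x t -> params X Hb2 x t ->
  Kmap X Hb1 x t = Kmap X Hb2 x t /\ pi1 x t = pi2 x t.
Proof.
move=> Xx xt1 xt2; have [se _ _] := fe.
have [[_ dHb1 rpi1 _ _] _] := dp1; have [[_ dHb2 rpi2 _ _] _] := dp2.
have [C1 [T1 [T10 F1]]] := transport_to dp1 ke1 Xx xt1.
have [C2 [T2 [T20 F2]]] := transport_to dp2 ke2 Xx xt2.
have i0 : 0 <= (0 : R) <= 1 by rewrite lexx ler01.
have i1 : 0 <= (1 : R) <= 1 by rewrite lexx ler01.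
have [|||||||] := @transport_unique R n X e
  (fun j x => 'D_(delta_mx j 0) (pi1 x) 0) C1 T1 C2 T2
  (fun r => pi1 x (r *: t)) (fun r => pi2 x (r *: t)) oX se.
- by move=> j; exact: (smooth_connection dHb1 rpi1).
- by move=> r r01; have [? _ _ _] := F1 r r01; have [? _ _ _] := F2 r r01.
- by move=> r r01; have [_ _ _] := F1 r r01.
(* Uniqueness concerns a single equation, so the two connections are exchanged here. *)
- move=> r r01; have [XC _ _] := F2 r r01; rewrite /transport_eqs.
  suff -> : \sum_j T2 r j 0 *: 'D_(delta_mx j 0) (pi1 (C2 r)) 0 =
    \sum_j T2 r j 0 *: 'D_(delta_mx j 0) (pi2 (C2 r)) 0 by [].
  by apply: eq_bigr => j _; congr (_ *: _); exact: connection_unique.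
- have [_ _ -> _] := F1 0 i0; have [_ _ -> _] := F2 0 i0.
  by rewrite scale0r (Kmap0 dHb1)// (Kmap0 dHb2).
- by rewrite T10 T20.
- have [_ _ pi10] := rpi1; have [_ _ pi20] := rpi2.
  by rewrite /= scale0r pi10// pi20.
have [_ _ -> _] := F1 1 i1; have [_ _ -> _] := F2 1 i1.
by rewrite scale1r => /addrI.
Qed.

(* Along the ray r t, K1 and K2 agree as long as r t stays in the domain of K2,
   and it cannot leave this domain because K1 (r t) stays in that of Hb2. *)
Lemma params_sub x t : X x -> params X Hb1 x t -> params X Hb2 x t.
Proof.
move=> Xx xt.
have [[_ dHb1 _ _ _] _] := dp1; have [[_ dHb2 _ _ _] _] := dp2.
have [C1 [T1 [_ F1]]] := transport_to dp1 ke1 Xx xt.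
have star (r : R) : 0 <= r <= 1 -> params X Hb1 x (r *: t).
  by move=> r01; have [] := F1 r r01.
have cray (s : R) : {for s, continuous (fun r : R => r *: t)}.
  exact: scalel_continuous.
rewrite -[t]scale1r.
apply: (@unit_interval_induction R (fun r => params X Hb2 x (r *: t))) => [||s|].
- by rewrite scale0r; exact: (params0 dHb2).
- move=> s /andP[s0 s1] lt_s.
  have s01 : 0 <= s <= 1 by rewrite s1 ltW.
  pose v r := Kmap X Hb1 x (r *: t).
  have xv : shifts X x (v s) by exact: (shifts_Kmap dHb1 Xx (star s s01)).
  (* [v s] is a shift at [x], and shifts do not depend on the group, so [Hb2 x (v s)] is meaningful;
     the equality is a limit from the left. *)
  suff <- : Hb2 x (v s) = s *: t by exact: params_H.
  have cv : {for s, continuous v}.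
    apply: continuous_comp; first exact: cray.
    exact/differentiable_continuous/(differentiable_Kmap dHb1 Xx (star s s01)).
  have cHv : {for s, continuous (fun r => Hb2 x (v r))}.
    apply: continuous_comp; first exact: cv.
    exact: smooth_on_continuous (smooth_H dHb2 Xx) xv.
  apply/eqP; rewrite -subr_eq0; apply/eqP/matrixP => i j; rewrite [RHS]mxE.
  apply: (@eq0_of_left R (fun r => (Hb2 x (v r) - r *: t) i j)) => //.
    apply: (@continuous_comp _ _ _ (fun r => Hb2 x (v r) - r *: t)
      (fun N : 'cV[R]_n => N i j)); last exact: coord_continuous.
    by apply: continuousB.
  move=> r /andP[r0 rs]; have r2 : params X Hb2 x (r *: t) by apply: lt_s; rewrite r0.
  have r1 : params X Hb1 x (r *: t).
    by apply: star; rewrite r0 (le_trans (ltW rs)).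
  have [E _] := transports_agree Xx r1 r2.
  by rewrite /v E (deformationK dHb2)// subrr mxE.
- move=> /andP[s0 s1] Ps.
  have : \forall r \near s, params X Hb2 x (r *: t).
    by apply: cray; apply: open_nbhs_nbhs; split=> //; exact: (open_params dHb2).
  move=> /nbhs_ballP[d /= d0 dP]; exists (d / 2); first by rewrite divr_gt0.
  move=> r /andP[sr rd]; apply: dP; rewrite /ball/= ler0_norm; lra.
- by rewrite ler01 lexx.
Qed.

End ParallelTransports.

(** The underlying [H1] and [H2] may differ. Each deformation map is compared where it is
    meaningful: [Hb] on shifts, [pi] on parameters. *)
Theorem proposition4 (R : realType) (n : nat) (X : set 'cV[R]_n)
    (eta : 'M[R]_n) (g e : 'cV[R]_n -> 'M[R]_n)
    (HX : open X)
    (Heta : euclidean eta)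
    (Hg : riemannian_metric X g)
    (He : orthonormal_frame X eta g e)
    (H1 Hb1 H2 Hb2 : 'cV[R]_n -> 'cV[R]_n -> 'cV[R]_n)
    (pi1 pi2 : 'cV[R]_n -> 'cV[R]_n -> 'M[R]_n)
    (DP1 : is_DP X eta H1 Hb1 pi1)
    (DP2 : is_DP X eta H2 Hb2 pi2)
    (frame1 : forall x, X x -> kmx X H1 x = e x)
    (frame2 : forall x, X x -> kmx X H2 x = e x) :
  forall x, X x ->
    (forall v, shifts X x v -> Hb1 x v = Hb2 x v) /\
    (forall t, params X Hb1 x t -> pi1 x t = pi2 x t).
Proof.
move=> x Xx; have [[_ dHb1 _ _ _] _] := DP1; have [[_ dHb2 _ _ _] _] := DP2.
have agree t : params X Hb1 x t -> params X Hb2 x t /\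
    (Kmap X Hb1 x t = Kmap X Hb2 x t /\ pi1 x t = pi2 x t).
  move=> xt1.
  have xt2 := params_sub HX Heta Hg He DP1 DP2 frame1 frame2 Xx xt1.
  split; first exact: xt2.
  exact: (transports_agree HX Heta Hg He DP1 DP2 frame1 frame2 Xx xt1 xt2).
split=> [v xv|t /agree[_ [_ ->]]//].
(* At the parameter [Hb1 x v], equality of the inverses sends it back to [v] through the second
   group, which gives equality of the maps. *)
have [xt2 [E _]] := agree _ (params_H Hb1 xv).
have Kv : Kmap X Hb2 x (Hb1 x v) = v by rewrite -E (KmapK dHb1).
by rewrite -[in RHS]Kv (deformationK dHb2).
Qed.
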